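(* Let $0<p<1$ and let $ZC1_n$ be the first Zagreb connection index of the random polyomino chain $RPC(n,p)$. Then, as $n\to\infty$, $$\frac{ZC1_n-(50-18p+2p^2-2p^3)n}{\sqrt n}\xrightarrow{D} N(0,\sigma^2),\qquad \sigma^2=4p(1-p)(5p^4-7p^3+56p^2-35p+81).$$
   Context: A polyomino chain with $n$ squares is a sequence of unit squares $S_1,\dots,S_n$ in the plane in which consecutive squares share exactly one edge and the centers of consecutive squares form a path; it is regarded as the graph whose vertices are the corners of the squares and whose edges are the sides of the squares. For $3\le k\le n$, the link $L_k\in\{1,2\}$ is $1$ if $S_k$ is attached to $S_{k-1}$ so that $S_{k-2},S_{k-1},S_k$ lie on a straight line, and $2$ if $S_k$ is attached to a side of $S_{k-1}$ adjacent to the side shared with $S_{k-2}$ (a turn). The random polyomino chain $RPC(n,p)$ is obtained by starting from one square, attaching a second square, and for $k=3,\dots,n$ attaching $S_k$ with link $L_k$, where $L_3,\dots,L_n$ are independent with $\mathbb P(L_k=1)=p$, $\mathbb P(L_k=2)=1-p$. For a vertex $v$, $\tau_v$ is the number of vertices at distance exactly $2$ from $v$; $ZC1_n=\sum_{v}\tau_v^2$ computed in $RPC(n,p)$. $N(\mu,\sigma^2)$ is the normal distribution and $\xrightarrow{D}$ denotes convergence in distribution. *)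

(* Defs.v *)
From HB Require Import structures.
From mathcomp Require Import all_boot all_order all_algebra.
From mathcomp Require Import all_classical all_reals all_analysis.

Set Implicit Arguments.
Unset Strict Implicit.
Unset Printing Implicit Defensive.

Import Order.TTheory GRing.Theory Num.Theory.
Local Open Scope ring_scope.

(* Lattice points of Z^2; a unit square ("cell") is identified with the
   lattice point of its lower-left corner. *)
Definition pt := (int * int)%type.

Definition addp (a b : pt) : pt := (a.1 + b.1, a.2 + b.2).
Definition rotL (d : pt) : pt := (- d.2, d.1).
Definition rotR (d : pt) : pt := (d.2, - d.1).

(* [build pos dir left ls]: the squares attached after the square at [pos],
   the last step having direction [dir]; [ls] is the sequence of links,
   [true] meaning link 1 (straight) and [false] meaning link 2 (turn).
   Successive turns alternate between left and right ([left] tells the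
   direction of the next turn), i.e. the chain is drawn as a staircase /
   zigzag, which is the standard convention making the chain a genuine
   chain (no non-consecutive squares sharing an edge). *)
Fixpoint build (pos dir : pt) (left : bool) (ls : seq bool) : seq pt :=
  match ls with
  | [::] => [::]
  | b :: ls' =>
      if b then let q := addp pos dir in q :: build q dir left ls'
      else let d := if left then rotL dir else rotR dir in
           let q := addp pos d in q :: build q d (~~ left) ls'
  end.

(* The squares S_1, ..., S_n of the chain with links L_3, ..., L_n given by
   [ls] (so [size ls = n - 2]). S_1 at (0,0), S_2 at (1,0). *)
Definition chain_cells (ls : seq bool) : seq pt :=
  (0, 0) :: (1, 0) :: build (1, 0) (1, 0) true ls.

Definition corners (c : pt) : seq pt :=
  [:: c; addp c (1, 0); addp c (1, 1); addp c (0, 1)].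

Definition is_side (c u v : pt) : bool :=
  let cs := corners c in
  has (fun i => ((u == nth c cs i) && (v == nth c cs (i.+1 %% 4)%N))
             || ((v == nth c cs i) && (u == nth c cs (i.+1 %% 4)%N))) (iota 0 4).

Definition vertices (ls : seq bool) : seq pt :=
  undup (flatten (map corners (chain_cells ls))).

Definition adj (ls : seq bool) (u v : pt) : bool :=
  has (fun c => is_side c u v) (chain_cells ls).

Definition dist2 (ls : seq bool) (v w : pt) : bool :=
  [&& w != v, ~~ adj ls v w & has (fun u => adj ls v u && adj ls u w) (vertices ls)].

Definition tau (ls : seq bool) (v : pt) : nat := count (dist2 ls v) (vertices ls).

Definition ZC1 (ls : seq bool) : nat := \sum_(v <- vertices ls) (tau ls v) ^ 2.

(* links L_3..L_n encoded by L : {ffun 'I_(n-2) -> bool}, L i = L_(i+3);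
   true = link 1 (probability p), false = link 2 (probability 1-p) *)
Definition links_seq (n : nat) (L : {ffun 'I_(n - 2) -> bool}) : seq bool :=
  [seq L i | i <- enum 'I_(n - 2)].

Definition link_weight {R : realType} (p : R) (n : nat)
  (L : {ffun 'I_(n - 2) -> bool}) : R :=
  \prod_(i < n - 2) (if L i then p else 1 - p).

Definition zc1_mean_coef {R : realType} (p : R) : R :=
  50 - 18 * p + 2 * p ^+ 2 - 2 * p ^+ 3.

Definition zc1_var {R : realType} (p : R) : R :=
  4 * p * (1 - p) * (5 * p ^+ 4 - 7 * p ^+ 3 + 56 * p ^+ 2 - 35 * p + 81).

Definition zc1_cdf {R : realType} (p : R) (n : nat) (x : R) : R :=
  \sum_(L : {ffun 'I_(n - 2) -> bool} |
        ((ZC1 (links_seq L))%:R - zc1_mean_coef p * n%:R) / Num.sqrt (n%:R) <= x)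
    link_weight p L.

(* Main.v *)
Require Import Defs.
From HB Require Import structures.
From mathcomp Require Import all_boot all_order all_algebra.
From mathcomp Require Import all_classical all_reals all_analysis.
From mathcomp Require Import measurable_realfun zify ring lra.

(* The chain is a monotone staircase, the cells having consecutive values of
   x + y, so tau at a vertex only depends on the five nearest cells. Up to
   bounded boundary terms, ZC1 is therefore the sum over k of
   50 - 9 (a + c) + 2 a c - 2 a b c, where a, b, c are the indicators of
   "link 1" for three consecutive links. Solving the Poisson equation of the
   chain of the last two links turns the centred sum into a martingale
   M = sum_i (w_i - p) A(w_(i-2), w_(i-1)) plus a bounded term, and
   p (1 - p) E A^2 is the announced variance v.
     The central limit theorem for W = M / sqrt n is proved by Stein's method.
   Integrating out one bit at a time gives
   E [W f(W)] = E [(T / n) f'(W)] + O(n^(-1/2)) with T = sum_i p (1 - p) A_i D_i M,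
   D_i being the discrete derivative; T / n concentrates at v since it has
   bounded differences and E T = E M^2 = n v + O(1). If psi is Lipschitz with
   compact support and mean zero under N(0, v), then v f' - x f = v psi has a
   compactly supported solution f, so E psi(W) tends to 0; trapezoidal psi and
   Chebyshev's inequality then give the distribution functions. *)

Set Implicit Arguments.
Unset Strict Implicit.
Unset Printing Implicit Defensive.

Import Order.TTheory GRing.Theory Num.Theory.
Import numFieldNormedType.Exports.
Local Open Scope ring_scope.

(** * The first Zagreb connection index as a local functional *)

Section CellLists.
Implicit Types (c u v w t : pt) (cs B : seq pt).

(** Either step of the staircase raises it by one, so it numbers the cells of the chain and grades
    its graph. *)
Definition lev u : int := u.1 + u.2.
Definition verts cs : seq pt := undup (flatten (map corners cs)).
Definition adjc cs u v : bool := has (fun c => is_side c u v) cs.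
Definition dist2c cs v w : bool :=
  [&& w != v, ~~ adjc cs v w & has (fun u => adjc cs v u && adjc cs u w) (verts cs)].
Definition tauc cs v : nat := count (dist2c cs v) (verts cs).

Lemma mem_verts cs v : (v \in verts cs) = has (fun c => v \in corners c) cs.
Proof.
rewrite mem_undup; elim: cs => // c cs IH.
by rewrite -[flatten _]/(corners c ++ flatten (map corners cs)) mem_cat IH.
Qed.

Lemma is_side_corners c u v : is_side c u v -> (u \in corners c) && (v \in corners c).
Proof.
rewrite /is_side /= !inE orbF => /or4P[] /orP[] /andP[/eqP -> /eqP ->];
  by rewrite !eqxx ?orbT.
Qed.

Lemma is_side_lev c u v : is_side c u v ->
  (lev v = lev u + 1 /\ lev c <= lev u <= lev c + 1) \/
  (lev u = lev v + 1 /\ lev c <= lev v <= lev c + 1).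
Proof.
case: c => x y; rewrite /is_side /lev /= orbF.
by case/or4P => /orP[] /andP[/eqP -> /eqP ->] /=; lia.
Qed.

(** Ends of edges are vertices, so the set counted by [tauc] is described by adjacency alone, the
    form in which two cell lists can be compared. *)
Lemma dist2c_verts cs v w : (dist2c cs v w && (w \in verts cs)) <->
  [/\ w != v, ~~ adjc cs v w & exists u, adjc cs v u && adjc cs u w].
Proof.
have adj_verts x y : adjc cs x y -> (x \in verts cs) && (y \in verts cs).
  case/hasP => c c_cs /is_side_corners/andP[xc yc]; rewrite !mem_verts.
  by apply/andP; split; apply/hasP; exists c.
split=> [/andP[/and3P[wv nvw /hasP[u _ vuw]] _]|[wv nvw [u vuw]]].
  by split=> //; exists u.
rewrite /dist2c wv nvw /=; case/andP: (vuw) => vu uw.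
have /andP[_ ->] := adj_verts _ _ uw; rewrite andbT; apply/hasP; exists u => //.
by have /andP[_ ->] := adj_verts _ _ vu.
Qed.

(** An edge at [u] belongs to cells of level between [lev u - 2] and [lev u]. Both edges of a path
    of length two from [v] have an end within one level of [v], hence the five levels of cells. *)
Lemma eq_tauc cs B v : {subset B <= cs} ->
  (forall c, c \in cs -> lev v - 3 <= lev c <= lev v + 1 -> c \in B) ->
  tauc cs v = tauc B v.
Proof.
move=> Bcs csB.
have adjE u w : lev v - 1 <= lev u <= lev v + 1 -> adjc cs u w = adjc B u w.
  move=> uv; apply/hasP/hasP => -[c c_in uw]; exists c => //; last exact: Bcs.
  by apply: csB => //; have := is_side_lev uw; lia.
have lev_adj u : adjc cs v u -> lev v - 1 <= lev u <= lev v + 1.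
  by case/hasP => c _ /is_side_lev; lia.
have vv : lev v - 1 <= lev v <= lev v + 1 by lia.
rewrite /tauc -!size_filter; apply: perm_size; apply: uniq_perm.
- by rewrite filter_uniq// undup_uniq.
- by rewrite filter_uniq// undup_uniq.
move=> w; rewrite !mem_filter; apply/idP/idP => /dist2c_verts[wv nvw [u /andP[vu uw]]];
  apply/dist2c_verts; split=> //; rewrite ?adjE// -?adjE//; exists u.
  by rewrite -!adjE ?vu// lev_adj.
have vu' : adjc cs v u by rewrite adjE.
by rewrite vu' adjE ?uw// lev_adj.
Qed.

Lemma addpA : associative addp.
Proof. by move=> [? ?] [? ?] [? ?]; rewrite /addp /= !addrA. Qed.

Lemma addpI t : injective (addp t).
Proof. by case: t => ? ? [? ?] [? ?] [/addrI -> /addrI ->]. Qed.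

Lemma corners_addp t c : corners (addp t c) = map (addp t) (corners c).
Proof. by rewrite /corners /= !addpA. Qed.

Lemma is_side_addp t c u v : is_side (addp t c) (addp t u) (addp t v) = is_side c u v.
Proof. by rewrite /is_side /= -!addpA !(inj_eq (@addpI t)). Qed.

Lemma verts_addp t cs : verts (map (addp t) cs) = map (addp t) (verts cs).
Proof.
rewrite /verts -(undup_map_inj (@addpI t)) map_flatten -!map_comp; congr (undup (flatten _)).
by apply: eq_map => c; exact: corners_addp.
Qed.

Lemma adjc_addp t cs u v : adjc (map (addp t) cs) (addp t u) (addp t v) = adjc cs u v.
Proof. by rewrite /adjc has_map; apply: eq_has => c /=; exact: is_side_addp. Qed.

Lemma tauc_addp t cs v : tauc (map (addp t) cs) (addp t v) = tauc cs v.
Proof.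
rewrite /tauc verts_addp count_map; apply: eq_count => w /=.
rewrite /dist2c (inj_eq (@addpI t)) adjc_addp verts_addp has_map.
by congr [&& _, _ & _]; apply: eq_has => u /=; rewrite !adjc_addp.
Qed.

Lemma tauc_le cs v : (tauc cs v <= 4 * size cs)%N.
Proof.
apply: leq_trans (count_size _ _) _; apply: leq_trans (size_undup _) _.
by elim: cs => //= c cs IH; rewrite !mulnS /=; lia.
Qed.

End CellLists.

(** * Monotone staircases of cells *)

Definition step (d : bool) : pt := if d then (1, 0) else (0, 1).

Fixpoint stair (c : pt) (ds : seq bool) : seq pt :=
  c :: if ds is d :: ds' then stair (addp c (step d)) ds' else [::].

Fixpoint turns (d : bool) (ls : seq bool) : seq bool :=
  if ls is b :: ls' then (d == b) :: turns (d == b) ls' else [::].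

(** As turns alternate, the direction is east exactly when the next turn is to the left, so a single
    boolean carries both the [dir] and the [left] arguments of [build]. *)
Lemma chain_cells_stair ls :
  chain_cells ls = stair (0, 0) (true :: turns true ls).
Proof.
rewrite /chain_cells /=.
have buildE c d l : c :: build c (step d) d l = stair c (turns d l).
  elim: l c d => // b l IH c d /=.
  by case: b; case: d; rewrite /= -IH.
by rewrite -(buildE _ true).
Qed.

Section Stairs.
Implicit Types (c u v : pt) (ds : seq bool).

Lemma size_stair c ds : size (stair c ds) = (size ds).+1.
Proof. by elim: ds c => //= d ds IH c; rewrite IH. Qed.

Lemma lev_addp u v : lev (addp u v) = lev u + lev v.
Proof. by rewrite /lev /addp /=; ring. Qed.

Lemma lev_nth_stair c ds k : (k <= size ds)%N ->
  lev (nth c (stair c ds) k) = lev c + k%:Z.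
Proof.
move=> kds; rewrite (set_nth_default (0, 0)) ?size_stair//.
elim: ds c k kds => [|d ds IH] c [|k] //=; rewrite ?addr0// => kds.
by rewrite IH// lev_addp; case: d; rewrite /lev /=; lia.
Qed.

Lemma take_stair c ds k : take k.+1 (stair c ds) = stair c (take k ds).
Proof. by elim: ds c k => [|d ds IH] c [|k] //=; congr cons; rewrite ?take0// IH. Qed.

Lemma drop_stair c ds k : (k <= size ds)%N ->
  drop k (stair c ds) = stair (nth c (stair c ds) k) (drop k ds).
Proof.
elim: ds c k => [|d ds IH] c [|k] //= kds; rewrite IH//.
by congr stair; apply: set_nth_default; rewrite size_stair.
Qed.

Lemma stair_addp t c ds : stair (addp t c) ds = map (addp t) (stair c ds).
Proof. by elim: ds c => //= d ds IH c; rewrite -IH addpA. Qed.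

(** Lists once each vertex other than the lower left corner of the first cell: the upper right
    corner of a cell is the lower right or upper left corner of the next one, so only the last cell
    contributes its own. *)
Fixpoint stair_tops (c : pt) (ds : seq bool) : seq pt :=
  [:: addp c (1, 0), addp c (0, 1) &
    if ds is d :: ds' then stair_tops (addp c (step d)) ds' else [:: addp c (1, 1)]].

Lemma lev_stair_tops c ds u : u \in stair_tops c ds -> lev c + 1 <= lev u.
Proof.
elim: ds c => [|d ds IH] c /=; rewrite !inE => /or3P[/eqP->|/eqP->|];
  rewrite ?lev_addp ?lerD2l//.
  by move/eqP ->; rewrite lev_addp; rewrite /lev /=; lia.
by move/IH; rewrite lev_addp; case: d => /=; rewrite /lev /=; lia.
Qed.

(** For uniqueness, the two corners listed for [c] are one level above it and all later entries are
    higher. *)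
Lemma verts_stair c ds : perm_eq (verts (stair c ds)) (c :: stair_tops c ds).
Proof.
apply: uniq_perm; first exact: undup_uniq.
  rewrite cons_uniq; apply/andP; split.
    by apply/negP => /lev_stair_tops; rewrite gerDl.
  elim: ds c => [|d ds IH] c.
    case: c => x y; rewrite /= !inE /addp /= !xpair_eqE; lia.
  rewrite /= inE negb_or IH andbT -andbA; apply/and3P; split.
  - by case: c => x y; rewrite /addp /= xpair_eqE; lia.
  - apply/negP => /lev_stair_tops; rewrite !lev_addp.
    by case: d; rewrite /lev /=; lia.
  - apply/negP => /lev_stair_tops; rewrite !lev_addp.
    by case: d; rewrite /lev /=; lia.
move=> u; rewrite mem_undup; elim: ds c => [|d ds IH] c.
  by rewrite /= !inE; congr (_ || (_ || _)); exact: orbC.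
rewrite -[flatten _]/(corners c ++ flatten (map corners (stair (addp c (step d)) ds))).
rewrite mem_cat IH !inE.
have -> : (u == addp c (1, 1)) = (u == addp (addp c (step d)) (step (~~ d))).
  by rewrite -addpA; case: d.
have : u == addp (addp c (step d)) (step (~~ d)) -> u \in stair_tops (addp c (step d)) ds.
  by move/eqP ->; case: (ds) => [|? ?]; case: d; rewrite /= !inE eqxx ?orbT.
set EN := u == addp _ (step (~~ d)); set X := u \in stair_tops _ _ => ENX.
have {ENX} -> : X = EN || X by move: ENX; case: EN; case: X => // /(_ isT).
rewrite /step; move: EN X (u == c) => e x b0.
case: d; case: (u == addp c (1, 0)); case: (u == addp c (0, 1));
  by case: b0; case: e; case: x.
Qed.

End Stairs.

(** * Reduction of the index to a sum over windows of three links *)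

Section LocalFormula.
Implicit Types (c u v : pt) (ds ls : seq bool).

Local Notation nthc := (nth (0, 0) : seq pt -> nat -> pt).

(** The window consists of the cells of index [l - 3] to [l + 1], as in [eq_tauc]. For [l < 3] the
    truncated subtraction starts it at the first cell; the surplus cells at its end are harmless. *)
Lemma tauc_window c ds v (l : nat) : lev v = lev c + l%:Z ->
  tauc (stair c ds) v = tauc (take 5 (drop (l - 3) (stair c ds))) v.
Proof.
move=> vl; apply: eq_tauc => [u /mem_take/mem_drop //|u u_in].
have kds : (index u (stair c ds) < (size ds).+1)%N.
  by rewrite -(size_stair c) index_mem.
have := lev_nth_stair c kds; rewrite nth_index// => -> uv.
set k := index u _ in kds uv *.
have k5 : (k - (l - 3) < 5)%N by lia.
have -> : u = nth c (take 5 (drop (l - 3) (stair c ds))) (k - (l - 3)).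
  by rewrite nth_take// nth_drop subnKC ?nth_index//; lia.
rewrite mem_nth// size_take size_drop size_stair; case: (ltnP 5) => _ //; lia.
Qed.

Lemma tauc_stair_le c ds v : v \in c :: stair_tops c ds ->
  (tauc (stair c ds) v <= 20)%N.
Proof.
move=> v_in; have cv : lev c <= lev v.
  by move: v_in; rewrite inE => /orP[/eqP -> //|/lev_stair_tops]; lia.
rewrite (@tauc_window c ds v `|lev v - lev c|%N); last by lia.
apply: leq_trans (tauc_le _ _) _; rewrite size_take.
by case: ltnP => //; lia.
Qed.

Definition pair_sq (cs : seq pt) c : nat :=
  (tauc cs (addp c (1, 0)%R) ^ 2 + tauc cs (addp c (0, 1)%R) ^ 2)%N.

Local Notation east := ((1, 0)%R : pt).
Local Notation north := ((0, 1)%R : pt).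
Local Notation northeast := ((1, 1)%R : pt).

Lemma big_stair_tops (F : pt -> nat) c ds :
  (\sum_(v <- stair_tops c ds) F v =
  \sum_(u <- stair c ds) (F (addp u east) + F (addp u north)) +
  F (addp (last c (stair c ds)) northeast))%N.
Proof.
elim: ds c => [|d ds IH] c.
  rewrite -[stair_tops _ _]/[:: addp c east; addp c north; addp c northeast].
  by rewrite -[stair _ _]/[:: c] !big_cons !big_nil !addn0 addnA.
rewrite -[stair_tops c _]/[:: addp c east, addp c north & stair_tops (addp c (step d)) ds].
rewrite -[stair c _]/(c :: stair (addp c (step d)) ds).
have -> : last c (c :: stair (addp c (step d)) ds) =
    last (addp c (step d)) (stair (addp c (step d)) ds) by case: (ds).
by rewrite !big_cons IH !addnA.
Qed.

(* 50 - 9 (a + c) + 2 a c - 2 a b c: the contribution of the lower right and upper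
   left corners of a cell whose five-cell neighbourhood has links [a], [b], [c]. *)
Definition window_sq (a b c : bool) : nat :=
  if a && c then (if b then 32 else 34) else if a || c then 41 else 50.

Lemma pair_sq_window w0 w1 w2 w3 :
  let cs := stair (0, 0) [:: w0; w1; w2; w3] in
  pair_sq cs (nthc cs 2) = window_sq (w0 == w1) (w1 == w2) (w2 == w3).
Proof. by case: w0; case: w1; case: w2; case: w3; vm_compute. Qed.

(** Both corners have level [lev c + k + 3], so their window starts at index [k]; translated to the
    origin, it is one of the sixteen cases of [pair_sq_window]. *)
Lemma pair_sq_stair c ds k : (k.+4 <= size ds)%N ->
  pair_sq (stair c ds) (nthc (stair c ds) k.+2) =
  window_sq (nth true ds k == nth true ds k.+1)
    (nth true ds k.+1 == nth true ds k.+2) (nth true ds k.+2 == nth true ds k.+3).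
Proof.
move=> kds; set u := nth c (stair c ds) k.
have k_le : (k <= size ds)%N by lia.
pose w := [:: nth true ds k; nth true ds k.+1; nth true ds k.+2; nth true ds k.+3].
have dropE : drop k ds = w ++ drop k.+4 ds.
  by rewrite /w /= -!(drop_nth true)//; lia.
have windowE : take 5 (drop k (stair c ds)) = map (addp u) (stair (0, 0) w).
  rewrite drop_stair// take_stair dropE take_size_cat// -stair_addp.
  by congr stair; rewrite /u /addp !addr0 -surjective_pairing.
have u2 : nthc (stair c ds) k.+2 = addp u (nthc (stair (0, 0) w) 2).
  rewrite -(nth_map _ (0, 0)) // -windowE nth_take// nth_drop addn2.
  by apply: set_nth_default; rewrite size_stair; lia.
have lev_u d : lev (addp (nthc (stair c ds) k.+2) (step d)) = lev c + k.+3%:Z.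
  rewrite lev_addp (set_nth_default c) ?size_stair ?lev_nth_stair//; try lia.
  by case: d; rewrite /lev /=; lia.
rewrite /pair_sq (tauc_window ds (lev_u true)) (tauc_window ds (lev_u false)).
have -> : (k.+3 - 3 = k)%N by lia.
rewrite windowE u2 -!(addpA u) !tauc_addp.
exact: (pair_sq_window (nth true ds k)).
Qed.

(** [a] and [b] are the two links preceding [s]. *)
Fixpoint link_sum (a b : bool) (s : seq bool) : nat :=
  if s is x :: s' then (window_sq a b x + link_sum b x s')%N else 0%N.

Lemma nth_turns d ls k : (k < size ls)%N ->
  (nth true (d :: turns d ls) k == nth true (d :: turns d ls) k.+1) = nth true ls k.
Proof.
elim: ls d k => [|b ls IH] d [|k] //= kls; first by case: d; case: b.
by rewrite -(IH (d == b) k kls).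
Qed.

Lemma size_turns d ls : size (turns d ls) = size ls.
Proof. by elim: ls d => //= b ls IH d; rewrite IH. Qed.

Lemma link_sumE a b s : link_sum a b s =
  (\sum_(k < size s) window_sq (nth true [:: a, b & s] k)
    (nth true (b :: s) k) (nth true s k))%N.
Proof.
elim: s a b => [|x s IH] a b; first by rewrite big_ord0.
by rewrite big_ord_recl /= IH; congr addn; apply: eq_bigr.
Qed.

(** The remainder gathers the two extreme corners, at most [20 ^ 2 = 400] each, and the first two
    and last two cells, at most 800 each: [2 * 400 + 4 * 800 = 4000]. *)
Lemma ZC1_link_sum a b s : exists2 r : nat,
  (r <= 4000)%N & ZC1 [:: a, b & s] = (link_sum a b s + r)%N.
Proof.
set ls := [:: a, b & s]; set ds := true :: turns true ls.
pose cs := stair (0, 0) ds.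
have tau_le v : v \in (0, 0) :: stair_tops (0, 0) ds -> (tauc cs v ^ 2 <= 400)%N.
  by move=> /tauc_stair_le; rewrite -[400%N]/(20 ^ 2)%N leq_exp2r.
have ZE : ZC1 ls = (tauc cs (0, 0)%R ^ 2 + \sum_(k < (size s).+4) pair_sq cs (nthc cs k)
    + tauc cs (addp (last (0, 0)%R cs) northeast) ^ 2)%N.
  rewrite /ZC1 -[vertices ls]/(verts (chain_cells ls)).
  under eq_bigr do rewrite -[tau _ _]/(tauc (chain_cells ls) _).
  rewrite chain_cells_stair -/ds -/cs (perm_big _ (verts_stair _ _)) big_cons big_stair_tops.
  apply: etrans (addnA _ _ _) _; congr (_ + _ + _)%N.
  by rewrite (big_nth (0, 0)) big_mkord size_stair /= size_turns.
have pair_le k : (k < (size s).+4)%N -> (pair_sq cs (nthc cs k) <= 800)%N.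
  move=> k_lt; have tops u : u \in cs -> (addp u (1, 0) \in stair_tops (0, 0) ds) &&
      (addp u (0, 1) \in stair_tops (0, 0) ds).
    rewrite /cs; elim: (ds) (0, 0) => [|d l IH] c /=; rewrite !inE.
      by move/eqP ->; rewrite !eqxx orbT.
    by case/orP => [/eqP ->|/IH/andP[-> ->]]; rewrite ?eqxx ?orbT.
  have /tops/andP[t1 t2] : nthc cs k \in cs by rewrite mem_nth// size_stair /= size_turns.
  rewrite /pair_sq; apply: (@leq_add _ _ 400 400); apply: tau_le;
    by rewrite inE ?t1 ?t2 orbT.
have origin_le : (tauc cs (0, 0)%R ^ 2 <= 400)%N by rewrite tau_le// mem_head.
have last_le : (tauc cs (addp (last (0, 0)%R cs) northeast) ^ 2 <= 400)%N.
  apply: tau_le; rewrite inE; apply/orP; right; rewrite /cs.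
  elim: (ds) (0, 0) => [|d l IH] c /=; rewrite !inE ?eqxx ?orbT//.
  have -> : last c (stair (addp c (step d)) l) =
      last (addp c (step d)) (stair (addp c (step d)) l) by case: (l).
  by rewrite IH !orbT.
have sumE : (\sum_(k < size s) pair_sq cs (nthc cs k.+2) = link_sum a b s)%N.
  rewrite link_sumE; apply: eq_bigr => k _.
  have k_lt := ltn_ord k.
  rewrite pair_sq_stair; last by rewrite /= size_turns.
  by rewrite !nth_turns /ls //=; lia.
have splitE (F : nat -> nat) n :
    (\sum_(k < n.+4) F k = F 0 + F 1 + \sum_(k < n) F k.+2 + F n.+2 + F n.+3)%N.
  by rewrite 2!big_ord_recl 2!big_ord_recr /= !addnA.
rewrite ZE (splitE (fun k => pair_sq cs (nthc cs k))) sumE.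
have [P0 P1] := (pair_le 0%N isT, pair_le 1%N isT).
have P2 : (pair_sq cs (nthc cs (size s).+2) <= 800)%N by apply: pair_le.
have P3 : (pair_sq cs (nthc cs (size s).+3) <= 800)%N by apply: pair_le.
move: origin_le last_le P0 P1 P2 P3.
set x0 := (_ ^ 2)%N; set x1 := (_ ^ 2)%N.
set p0 := pair_sq _ _; set p1 := pair_sq _ _; set p2 := pair_sq _ _; set p3 := pair_sq _ _.
move: x0 x1 p0 p1 p2 p3 (link_sum a b s) => x0 x1 p0 p1 p2 p3 S *.
by exists (x0 + x1 + p0 + p1 + p2 + p3)%N; lia.
Qed.

End LocalFormula.

(** * Expectation over independent bits *)

Section BernoulliExpectation.
Variables (R : realFieldType) (p : R).

Fixpoint bern_exp (m : nat) (g : seq bool -> R) : R :=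
  if m is m'.+1 then p * bern_exp m' (fun s => g (true :: s)) +
                     (1 - p) * bern_exp m' (fun s => g (false :: s))
  else g [::].

Lemma bern_expS m g : bern_exp m.+1 g =
  p * bern_exp m (fun s => g (true :: s)) +
  (1 - p) * bern_exp m (fun s => g (false :: s)).
Proof. by []. Qed.

Lemma eq_bern_exp m (g h : seq bool -> R) :
  (forall s, size s = m -> g s = h s) -> bern_exp m g = bern_exp m h.
Proof.
elim: m g h => [|m IH] g h gh /=; first exact: gh.
by congr (_ * _ + _ * _); apply: IH => s sm; apply: gh; rewrite /= sm.
Qed.

Lemma bern_exp_cst m c : bern_exp m (fun=> c) = c.
Proof. by elim: m => //= m ->; ring. Qed.

Lemma bern_expD m g h :
  bern_exp m (fun s => g s + h s) = bern_exp m g + bern_exp m h.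
Proof. by elim: m g h => //= m IH g h; rewrite !IH; ring. Qed.

Lemma bern_expZ m c g : bern_exp m (fun s => c * g s) = c * bern_exp m g.
Proof. by elim: m g => //= m IH g; rewrite !IH; ring. Qed.

Lemma bern_expB m g h :
  bern_exp m (fun s => g s - h s) = bern_exp m g - bern_exp m h.
Proof. by elim: m g h => //= m IH g h; rewrite !IH; ring. Qed.

Lemma sum_ffun_bern_exp m (g : seq bool -> R) :
  \sum_(L : {ffun 'I_m -> bool})
    (\prod_(i < m) (if L i then p else 1 - p)) * g [seq L i | i <- enum 'I_m]
  = bern_exp m g.
Proof.
elim: m g => [|m IH] g /=.
  rewrite (eq_bigr (fun=> g [::])); last first.
    move=> L _; rewrite big_ord0 mul1r; congr g.
    by apply: size0nil; rewrite size_map size_enum_ord.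
  by rewrite sumr_const card_ffun card_ord expn0.
pose cons_ffun (u : bool * {ffun 'I_m -> bool}) : {ffun 'I_m.+1 -> bool} :=
  [ffun i => if unlift ord0 i is Some j then u.2 j else u.1].
pose uncons_ffun (L : {ffun 'I_m.+1 -> bool}) : bool * {ffun 'I_m -> bool} :=
  (L ord0, [ffun j => L (lift ord0 j)]).
rewrite (reindex cons_ffun) /=; last first.
  exists uncons_ffun => [[b L] _|L _].
    rewrite /uncons_ffun ffunE unlift_none; congr pair.
    by apply/ffunP => j; rewrite !ffunE liftK.
  by apply/ffunP => i; rewrite ffunE; case: unliftP => [j|] -> /=; rewrite ?ffunE.
rewrite -(pair_bigA _ (fun b L => (\prod_(i < m.+1)
    (if cons_ffun (b, L) i then p else 1 - p)) *
    g [seq cons_ffun (b, L) i | i <- enum 'I_m.+1])) /=.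
rewrite big_bool /= -!IH !mulr_sumr.
have bodyE b (L : {ffun 'I_m -> bool}) :
    (\prod_(i < m.+1) (if cons_ffun (b, L) i then p else 1 - p)) *
      g [seq cons_ffun (b, L) i | i <- enum 'I_m.+1] =
    (if b then p else 1 - p) * ((\prod_(i < m) (if L i then p else 1 - p)) *
      g (b :: [seq L i | i <- enum 'I_m])).
  rewrite big_ord_recl enum_ordSl /= ffunE unlift_none -mulrA.
  congr (_ * (_ * g (_ :: _))).
    by apply: eq_bigr => i _; rewrite ffunE liftK.
  by rewrite -map_comp; apply: eq_map => i /=; rewrite ffunE liftK.
by congr (_ + _); apply: eq_bigr => L _; rewrite bodyE.
Qed.

Hypotheses (p_ge0 : 0 <= p) (p_le1 : p <= 1).

Lemma ler_bern_exp m (g h : seq bool -> R) :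
  (forall s, size s = m -> g s <= h s) -> bern_exp m g <= bern_exp m h.
Proof.
elim: m g h => [|m IH] g h gh /=; first exact: gh.
have le b : bern_exp m (fun s => g (b :: s)) <= bern_exp m (fun s => h (b :: s)).
  by apply: IH => s sm; apply: gh; rewrite /= sm.
by apply: lerD; apply: ler_wpM2l; rewrite ?subr_ge0.
Qed.

Lemma ler_norm_bern_exp m g : `|bern_exp m g| <= bern_exp m (fun s => `|g s|).
Proof.
rewrite ler_norml -mulN1r -bern_expZ.
apply/andP; split; apply: ler_bern_exp => s _; last exact: ler_norm.
by rewrite mulN1r lerNl -normrN ler_norm.
Qed.

(* A form of the Efron-Stein inequality. *)
Lemma bern_exp_var m (g : seq bool -> R) c :
  (forall u v, (size (u ++ v)).+1 = m ->
     `|g (u ++ true :: v) - g (u ++ false :: v)| <= c) ->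
  bern_exp m (fun s => (g s - bern_exp m g) ^+ 2) <= m%:R * c ^+ 2.
Proof.
have varE k h : bern_exp k (fun s => (h s - bern_exp k h) ^+ 2) =
    bern_exp k (fun s => h s ^+ 2) - bern_exp k h ^+ 2.
  rewrite (@eq_bern_exp _ _ (fun s =>
    h s ^+ 2 - (2 * bern_exp k h) * h s + bern_exp k h ^+ 2)).
    by rewrite bern_expD bern_expB bern_expZ bern_exp_cst; ring.
  by move=> s _; ring.
elim: m g => [|m IH] g gc; first by rewrite /= subrr expr0n mul0r.
have tail b : bern_exp m (fun s => g (b :: s) ^+ 2) -
    bern_exp m (fun s => g (b :: s)) ^+ 2 <= m%:R * c ^+ 2.
  rewrite -varE; apply: IH => u v uv; apply: (gc (b :: u) v).
  by rewrite /= uv.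
have diff : (bern_exp m (fun s => g (true :: s)) -
    bern_exp m (fun s => g (false :: s))) ^+ 2 <= c ^+ 2.
  rewrite -bern_expB -real_normK ?num_real// lerXn2r ?nnegrE//.
    by apply: le_trans (gc [::] (nseq m true) _); rewrite //= size_nseq.
  apply: le_trans (ler_norm_bern_exp _ _) _.
  rewrite -[leRHS](bern_exp_cst m); apply: ler_bern_exp => s sm.
  by apply: (gc [::] s); rewrite /= sm.
(* Law of total variance for the first bit: the conditional variances are averaged, and
   [p * (1 - p)] times the squared difference of the conditional means is added. *)
rewrite varE /=; move: (tail true) (tail false) diff.
set a1 := bern_exp _ _; set a2 := bern_exp _ _.
set b1 := bern_exp _ _; set b2 := bern_exp _ _ => t1 t2 diff.
have q_ge0 : 0 <= 1 - p by rewrite subr_ge0.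
have pq : p * (1 - p) <= 1 by rewrite mulr_ile1// lerBlDr lerDl.
have := ler_wpM2l p_ge0 t1; have := ler_wpM2l q_ge0 t2.
have : p * (1 - p) * (a2 - b2) ^+ 2 <= 1 * c ^+ 2.
  by apply: ler_pM => //; [exact: mulr_ge0 | exact: sqr_ge0].
rewrite -natr1; set k := m%:R; set c2 := c ^+ 2.
clear. nra.
Qed.

(** * Martingales whose increments depend on the last two bits *)

Section LocalMartingale.
Variable A : bool -> bool -> R.

(** [a] and [b] are the last two bits before [s]. The factor [A a b] is known before [x] is drawn,
    so increments have conditional mean zero. *)
Fixpoint mart (a b : bool) (s : seq bool) : R :=
  if s is x :: s' then ((x : nat)%:R - p) * A a b + mart b x s' else 0.

(** The last factor is the discrete derivative of [mart a b] in its first bit, [s] being the bits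
    after it. Summing along the sequence, [grad] is the variable [T] of Stein's method. *)
Definition grad_head (a b : bool) (s : seq bool) : R :=
  p * (1 - p) * A a b * (A a b + mart b true s - mart b false s).

Fixpoint grad (a b : bool) (s : seq bool) : R :=
  if s is x :: s' then grad_head a b s' + grad b x s' else 0.

Variable B : R.
Hypothesis A_le : forall a b, `|A a b| <= B.

Let B_ge0 : 0 <= B. Proof. exact: le_trans (A_le true true). Qed.

Let bit_le (x : bool) : `|(x : nat)%:R - p| <= 1.
Proof. by rewrite ler_norml; case: x => /=; move: p_ge0 p_le1; lra. Qed.

Let pq_itv : 0 <= p * (1 - p) <= 1.
Proof. by move: p_ge0 p_le1; nra. Qed.

Let step_le (x : bool) (u v u' v' : bool) :
  `|((x : nat)%:R - p) * A u v - ((x : nat)%:R - p) * A u' v'| <= 2 * B.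
Proof.
rewrite -mulrBr normrM -[leRHS]mul1r ler_pM//.
by rewrite (le_trans (ler_normB _ _))// mulr2n mulrDl mul1r lerD.
Qed.

(** The initial state enters the first two increments only, and each changes by at most [2 * B]. *)
Lemma mart_state_le a b a' b' s : `|mart a b s - mart a' b' s| <= 4 * B.
Proof.
case: s => [|y [|z s]] /=; first by rewrite subrr normr0 mulr_ge0.
  by rewrite !addr0; apply: le_trans (step_le _ _ _ _ _) _; rewrite ler_wpM2r// ler_nat.
rewrite (_ : _ - _ =
  ((y : nat)%:R - p) * A a b - ((y : nat)%:R - p) * A a' b' +
  (((z : nat)%:R - p) * A b y - ((z : nat)%:R - p) * A b' y)); last by ring.
apply: le_trans (ler_normD _ _) _.
by apply: le_trans (lerD (step_le _ _ _ _ _) (step_le _ _ _ _ _)) _; rewrite -mulrDl -natrD.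
Qed.

Lemma grad_head_le a b s : `|grad_head a b s| <= 5 * B ^+ 2.
Proof.
rewrite /grad_head -addrA.
have : `|A a b + (mart b true s - mart b false s)| <= 5 * B.
  apply: le_trans (ler_normD _ _) _.
  by apply: le_trans (lerD (A_le _ _) (mart_state_le _ _ _ _ _)) _; lra.
move=> h; rewrite -mulrA normrM -[leRHS]mul1r ler_pM//.
  by rewrite ger0_norm; case/andP: pq_itv.
by rewrite normrM; apply: le_trans (ler_pM _ _ (A_le _ _) h) _ => //; rewrite mulrCA.
Qed.

Lemma grad_headB_le a b a' b' s s' :
  `|grad_head a b s - grad_head a' b' s'| <= 10 * B ^+ 2.
Proof.
apply: le_trans (ler_normB _ _) _.
by apply: le_trans (lerD (grad_head_le _ _ _) (grad_head_le _ _ _)) _; lra.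
Qed.

Lemma grad_state_le a b a' b' s : `|grad a b s - grad a' b' s| <= 20 * B ^+ 2.
Proof.
have B2 := sqr_ge0 B.
case: s => [|y [|z s]] /=; first by rewrite subrr normr0 mulr_ge0.
  rewrite !addr0; apply: le_trans (grad_headB_le _ _ _ _ _ _) _; lra.
rewrite opprD addrACA; apply: le_trans (ler_normD _ _) _.
apply: le_trans (lerD (grad_headB_le _ _ _ _ _ _) _) (_ : _ + 10 * B ^+ 2 <= _).
  rewrite opprD addrACA subrr addr0; exact: grad_headB_le.
by lra.
Qed.

(** A flip changes the two preceding summands, by at most [10 * B ^+ 2] each, and the state from
    which the later ones start, which costs [20 * B ^+ 2]. The summand at the flipped bit is a
    difference over both of its values and does not change. *)
Lemma grad_flip_le a b u v :
  `|grad a b (u ++ true :: v) - grad a b (u ++ false :: v)| <= 40 * B ^+ 2.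
Proof.
have B2 := sqr_ge0 B.
have flip0 a' b' : `|grad a' b' (true :: v) - grad a' b' (false :: v)| <= 20 * B ^+ 2.
  rewrite /= opprD addrACA.
  have -> : grad_head a' b' v - grad_head a' b' v = 0 by rewrite subrr.
  by rewrite add0r grad_state_le.
have flipS a' b' x w k :
    `|grad b' x (w ++ true :: v) - grad b' x (w ++ false :: v)| <= k ->
    `|grad a' b' (x :: w ++ true :: v) - grad a' b' (x :: w ++ false :: v)|
    <= 10 * B ^+ 2 + k.
  move=> h; rewrite /= opprD addrACA; apply: le_trans (ler_normD _ _) _.
  by apply: lerD => //; exact: grad_headB_le.
elim: u a b => [|x u IH] a b; first by apply: le_trans (flip0 _ _) _; lra.
case: u IH => [_|y u].
  by apply: le_trans (flipS a b x [::] _ (flip0 _ _)) _; lra.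
case: u => [_|z u IH].
  by apply: le_trans (flipS a b x [:: y] _ (flipS _ _ _ [::] _ (flip0 _ _))) _; lra.
rewrite [grad a b _]/= [X in _ - X]/=.
rewrite (_ : grad_head a b [:: y, z & u ++ true :: v] =
             grad_head a b [:: y, z & u ++ false :: v]); last first.
  by rewrite /grad_head /=; ring.
by rewrite opprD addrACA subrr add0r; exact: IH.
Qed.

Lemma bern_exp_mart m a b : bern_exp m (mart a b) = 0.
Proof.
elim: m a b => [//|m IH] a b; rewrite bern_expS /=.
by rewrite !bern_expD !bern_exp_cst !IH /=; ring.
Qed.

(* Integrating the bit [x] out of [(x - p) * A a b * f (y x)] leaves
   [p * (1 - p) * A a b * (f (y true) - f (y false))], a discrete derivative. *)
Lemma mart_stein (f df : R -> R) L e m a b c :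
  (forall x y, `|f y - f x - df x * (y - x)| <= L * (y - x) ^+ 2) ->
  `|bern_exp m (fun s => mart a b s * f (c + e * mart a b s)) -
    e * bern_exp m (fun s => grad a b s * df (c + e * mart a b s))|
  <= m%:R * (25 * B ^+ 3 * L * e ^+ 2).
Proof.
move=> fdf; have L_ge0 : 0 <= L.
  by have := le_trans (normr_ge0 _) (fdf 0 1); rewrite subr0 expr1n mulr1.
elim: m a b c => [|m IH] a b c.
  by rewrite /= !mul0r mulr0 subrr normr0.
pose c' (x : bool) := c + e * (((x : nat)%:R - p) * A a b).
pose F x s := f (c' x + e * mart b x s).
pose dF x s := df (c' x + e * mart b x s).
have argE x s : c + e * mart a b (x :: s) = c' x + e * mart b x s.
  by rewrite /c' /=; ring.
(* [rest x] is the error of the later bits, bounded by induction. [head x] compares the finite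
   difference of [f] left by the first bit with its linearisation at the point reached when that bit
   is [x]. *)
pose rest x := bern_exp m (fun s => mart b x s * F x s) -
               e * bern_exp m (fun s => grad b x s * dF x s).
pose head x := bern_exp m (fun s => p * (1 - p) * A a b * (F true s - F false s) -
                                    e * (grad_head a b s * dF x s)).
have -> : bern_exp m.+1 (fun s => mart a b s * f (c + e * mart a b s)) -
    e * bern_exp m.+1 (fun s => grad a b s * df (c + e * mart a b s)) =
    p * (rest true + head true) + (1 - p) * (rest false + head false).
  have E1 x : bern_exp m (fun s => mart a b (x :: s) * f (c + e * mart a b (x :: s)))
      = ((x : nat)%:R - p) * A a b * bern_exp m (F x) +
        bern_exp m (fun s => mart b x s * F x s).
    rewrite -bern_expZ -bern_expD; apply: eq_bern_exp => s _.
    by rewrite argE /F /=; ring.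
  have E2 x : bern_exp m (fun s => grad a b (x :: s) * df (c + e * mart a b (x :: s)))
      = bern_exp m (fun s => grad_head a b s * dF x s) +
        bern_exp m (fun s => grad b x s * dF x s).
    rewrite -bern_expD; apply: eq_bern_exp => s _.
    by rewrite argE /dF /=; ring.
  have E3 x : head x = p * (1 - p) * A a b * (bern_exp m (F true) - bern_exp m (F false))
      - e * bern_exp m (fun s => grad_head a b s * dF x s).
    by rewrite /head bern_expB !bern_expZ bern_expB.
  by rewrite !bern_expS !E1 !E2 !E3 /rest /=; ring.
have head_le x : `|head x| <= 25 * B ^+ 3 * L * e ^+ 2.
  apply: le_trans (ler_norm_bern_exp _ _) _.
  rewrite -[leRHS](bern_exp_cst m); apply: ler_bern_exp => s _.
  set d := A a b + mart b true s - mart b false s.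
  have d_le : `|d| <= 5 * B.
    rewrite /d -addrA; apply: le_trans (ler_normD _ _) _.
    by apply: le_trans (lerD (A_le _ _) (mart_state_le _ _ _ _ _)) _; lra.
  have dE : c' true + e * mart b true s - (c' false + e * mart b false s) = e * d.
    by rewrite /c' /d /=; ring.
  have dif : `|F true s - F false s - e * d * dF x s| <= L * (e * d) ^+ 2.
    (* For [x] true the expansion is about the other end point, so [fdf] is used with its two points
       exchanged. *)
    case: x; last by rewrite mulrC -dE; exact: fdf.
    rewrite -dE -sqrrN opprB -normrN.
    by apply: le_trans (fdf (c' true + e * mart b true s) _); rewrite le_eqVlt;
      apply/orP; left; apply/eqP; congr `| _ |; rewrite /F /dF; ring.
  have -> : p * (1 - p) * A a b * (F true s - F false s) - e * (grad_head a b s * dF x s)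
     = p * (1 - p) * (A a b * (F true s - F false s - e * d * dF x s)).
    by rewrite /grad_head -/d; ring.
  rewrite normrM -[leRHS]mul1r ler_pM//.
    by rewrite ger0_norm; case/andP: pq_itv.
  rewrite normrM.
  have -> : 25 * B ^+ 3 * L * e ^+ 2 = B * (L * (e ^+ 2 * (5 * B) ^+ 2)) by ring.
  apply: ler_pM => //; apply: le_trans dif _.
  rewrite exprMn; apply: ler_wpM2l => //; apply: ler_wpM2l; first exact: sqr_ge0.
  by rewrite -real_normK ?num_real// lerXn2r// nnegrE// mulr_ge0.
have tot x : `|rest x + head x| <= m.+1%:R * (25 * B ^+ 3 * L * e ^+ 2).
  apply: le_trans (ler_normD _ _) _; rewrite -addn1 natrD mulrDl mul1r.
  by apply: lerD; [exact: IH|exact: head_le].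
have q_ge0 : 0 <= 1 - p by rewrite subr_ge0.
apply: le_trans (ler_normD _ _) _; rewrite !normrM (ger0_norm p_ge0) (ger0_norm q_ge0).
apply: le_trans (lerD (ler_wpM2l p_ge0 (tot true)) (ler_wpM2l q_ge0 (tot false))) _.
by rewrite -mulrDl addrC subrK mul1r.
Qed.

(** The identity function has no Taylor remainder, so for it [mart_stein] holds with [L = 0] and
    becomes an equality. *)
Lemma bern_exp_grad m a b :
  bern_exp m (grad a b) = bern_exp m (fun s => mart a b s ^+ 2).
Proof.
have h (x y : R) : `|id y - id x - 1 * (y - x)| <= 0 * (y - x) ^+ 2.
  by rewrite mul1r subrr normr0 mul0r.
have := mart_stein 1 m a b 0 h; rewrite mulr0 mul0r mulr0 normr_le0 subr_eq0 mul1r.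
move/eqP => E; rewrite (@eq_bern_exp _ (grad a b) (fun s => grad a b s * 1)) -?E.
  by apply: eq_bern_exp => s _; rewrite /= add0r mul1r expr2.
by move=> s _; rewrite mulr1.
Qed.

(** The variance of an increment whose two preceding bits are random as well. *)
Definition mart_var := p * (1 - p) *
  (p * (p * A true true ^+ 2 + (1 - p) * A true false ^+ 2) +
   (1 - p) * (p * A false true ^+ 2 + (1 - p) * A false false ^+ 2)).

(* [u + E u] solves the Poisson equation for [u], since [E E u = 0]: the chain of
   the last two bits is stationary after two steps. *)
Lemma mart_sq m a b :
  let u a b := p * (1 - p) * A a b ^+ 2 - mart_var in
  bern_exp m.+2 (fun s => mart a b s ^+ 2) =
  m.+2%:R * mart_var + u a b + (p * u b true + (1 - p) * u b false).
Proof.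
move=> u.
have rec k a' b' : bern_exp k.+1 (fun s => mart a' b' s ^+ 2) =
    p * (1 - p) * A a' b' ^+ 2 +
    (p * bern_exp k (fun s => mart b' true s ^+ 2) +
     (1 - p) * bern_exp k (fun s => mart b' false s ^+ 2)).
  have E x : bern_exp k (fun s => mart a' b' (x :: s) ^+ 2) =
     (((x : nat)%:R - p) * A a' b') ^+ 2 + bern_exp k (fun s => mart b' x s ^+ 2).
    rewrite (@eq_bern_exp _ _ (fun s => (((x : nat)%:R - p) * A a' b') ^+ 2 +
      2 * (((x : nat)%:R - p) * A a' b') * mart b' x s + mart b' x s ^+ 2)).
      by rewrite !bern_expD bern_exp_cst bern_expZ bern_exp_mart mulr0 addr0.
    by move=> s _ /=; ring.
  by rewrite bern_expS !E /=; ring.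
elim: m a b => [|m IH] a b.
  by rewrite !rec /= expr0n /=  /u; ring.
rewrite rec !IH -[m.+3%:R]natr1 /u /mart_var; ring.
Qed.

End LocalMartingale.
End BernoulliExpectation.

(** * Stein's equation for the normal law *)

Local Open Scope classical_set_scope.
Local Open Scope ring_scope.

Section RealFunctions.
Variable R : realType.
Implicit Types (f df g : R -> R).

Lemma lipschitz_continuous g k :
  (forall x y, `|g y - g x| <= k * `|y - x|) -> continuous g.
Proof.
move=> gk x; apply/cvgrPdist_le => e e0; near=> y.
rewrite distrC; apply: le_trans (gk x y) _.
have k1 : k <= `|k| + 1 by rewrite ler_wpDr// ler_norm.
apply: le_trans (ler_wpM2r _ k1) _ => //.
have k2 : 0 < `|k| + 1 by rewrite ltr_wpDl.
rewrite mulrC -ler_pdivlMr// distrC; near: y.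
by apply: cvgr_dist_le => //; rewrite divr_gt0.
Unshelve. all: by end_near. Qed.

Lemma is_derive_continuous f df :
  (forall x : R, is_derive x 1 f (df x)) -> continuous f.
Proof.
by move=> fdf x; apply/differentiable_continuous/derivable1_diffP/ex_derive.
Qed.

Lemma is_derive_lipschitz f df k : (forall x : R, is_derive x 1 f (df x)) ->
  (forall x, `|df x| <= k) -> forall x y, `|f y - f x| <= k * `|y - x|.
Proof.
move=> fdf dfk x y; wlog xy : x y / x < y => [H|].
  have [xy|yx|->] := ltgtP x y; [exact: H| |by rewrite !subrr !normr0 mulr0].
  by rewrite distrC [X in _ * X]distrC; exact: H.
have [c _ ->] := MVT xy (fun z _ => fdf z)
  (continuous_subspaceT (is_derive_continuous fdf)).
by rewrite normrM ler_wpM2r.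
Qed.

(** A single use of the mean value theorem, hence [k] rather than the sharper [k / 2]. *)
Lemma is_derive_taylor1 f df k : (forall x : R, is_derive x 1 f (df x)) ->
  (forall x y, `|df y - df x| <= k * `|y - x|) ->
  forall x y, `|f y - f x - df x * (y - x)| <= k * (y - x) ^+ 2.
Proof.
move=> fdf dfk x y.
have k0 : 0 <= k by have := le_trans (normr_ge0 _) (dfk 0 1); rewrite subr0 normr1 mulr1.
have [->|xy] := eqVneq x y; first by rewrite !subrr mulr0 subrr normr0 expr0n mulr0.
have [c cxy ->] : exists2 c, `|c - x| <= `|y - x| & f y - f x = df c * (y - x).
  have := fun a b ab => MVT ab (fun z (_ : z \in `]a, b[) => fdf z)
    (continuous_subspaceT (is_derive_continuous fdf)).
  move: xy; rewrite neq_lt => /orP[xy|xy] /(_ _ _ xy)[c /[!in_itv]/= /andP[c1 c2] E].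
    by exists c => //; rewrite !ger0_norm; lra.
  exists c; last by rewrite -opprB E; ring.
  by rewrite !ler0_norm; lra.
rewrite -mulrBl normrM -(real_normK (num_real (y - x))) expr2 mulrA ler_wpM2r//.
by apply: le_trans (dfk _ _) _; rewrite ler_wpM2l.
Qed.

Lemma continuous_compact_support_bounded g r : continuous g ->
  (forall x, r < `|x| -> g x = 0) -> exists k, forall x, `|g x| <= k.
Proof.
move=> gc g0.
have rr : - `|r| <= `|r| by have := normr_ge0 r; lra.
have [c _ cmax] := @EVT_max R (fun x => `|g x|) (- `|r|) `|r| rr
  (continuous_subspaceT (fun x => cvg_norm (gc x))).
exists `|g c| => x; have [xr|xr] := leP `|x| `|r|.
  by apply: cmax; rewrite in_itv /= -ler_norml.
by rewrite g0 ?normr0//; apply: le_lt_trans xr; exact: ler_norm.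
Qed.

End RealFunctions.

Section NormalExpectation.
Variables (R : realType) (v : R).
Hypothesis v_gt0 : 0 < v.
Notation mu := (@lebesgue_measure R).
Implicit Types (f df g h : R -> R).

Let s_neq0 : Num.sqrt v != 0. Proof. by rewrite gt_eqF// sqrtr_gt0. Qed.

Local Notation phi := (normal_pdf 0 (Num.sqrt v)).

Definition normal_exp g : R := \int[mu]_x (g x * phi x).
Definition normal_cdf (x : R) : R := \int[mu]_(t in `]-oo, x]) phi t.

Lemma normal_cdfE x :
  normal_prob 0 (Num.sqrt v) `]-oo, x] = (normal_cdf x)%:E.
Proof.
rewrite /normal_cdf /Rintegral fineK//; apply: integrable_fin_num => //.
by apply: integrableS (integrable_normal_pdf 0 (Num.sqrt v)).
Qed.

Lemma is_derive_normal_pdf (x : R) : is_derive x 1 phi (- (x / v) * phi x).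
Proof.
rewrite normal_pdfE//.
have nE y : normal_fun 0 (Num.sqrt v) y = expR (- (2 * v)^-1 * y ^+ 2).
  rewrite /normal_fun subr0 sqr_sqrtr ?ltW// -[v *+ 2]mulr_natl.
  by congr expR; rewrite mulrC mulNr mulrN.
rewrite (_ : (fun _ => _) =
    (fun y => normal_peak (Num.sqrt v) * expR (- (2 * v)^-1 * y ^+ 2))).
  by apply: is_derive_eq; rewrite nE /GRing.scale /=; field; rewrite gt_eqF.
by apply/funext => y; rewrite nE.
Qed.

Lemma normal_pdf_gt0 x : 0 < phi x.
Proof.
by rewrite normal_pdfE// mulr_gt0 ?expR_gt0// normal_peak_gt0.
Qed.

Lemma integrable_normal_exp g k : measurable_fun setT g ->
  (forall x, `|g x| <= k) ->
  mu.-integrable setT (EFin \o (fun x => g x * phi x)).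
Proof.
move=> mg gk.
have kphi : mu.-integrable setT (fun x => (k * phi x)%:E).
  under [X in _.-integrable _ X]eq_fun do rewrite EFinM.
  by apply: integrableZl => //; exact: integrable_normal_pdf.
apply: le_integrable kphi => //.
  apply/measurable_EFinP; apply: measurable_funM => //; exact: measurable_normal_pdf.
move=> x _ /=; rewrite lee_fin !normrM ler_wpM2r//.
by apply: le_trans (gk x) _; exact: ler_norm.
Qed.

Lemma le_normal_exp g h k : measurable_fun setT g -> measurable_fun setT h ->
  (forall x, `|g x| <= k) -> (forall x, `|h x| <= k) ->
  (forall x, g x <= h x) -> normal_exp g <= normal_exp h.
Proof.
move=> mg mh gk hk gh; apply: le_Rintegral => //;
  [exact: integrable_normal_exp gk|exact: integrable_normal_exp hk|].
by move=> x _; rewrite ler_wpM2r// ltW// normal_pdf_gt0.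
Qed.

Lemma normal_expBZ g h k c : measurable_fun setT g -> measurable_fun setT h ->
  (forall x, `|g x| <= k) -> (forall x, `|h x| <= k) ->
  normal_exp (fun x => g x - c * h x) = normal_exp g - c * normal_exp h.
Proof.
move=> mg mh gk hk; have ig := integrable_normal_exp mg gk.
have ih := integrable_normal_exp mh hk.
rewrite /normal_exp -RintegralZl// -RintegralB//.
  by apply: eq_Rintegral => x _; ring.
under [X in _.-integrable _ X]eq_fun do rewrite /= EFinM.
exact: integrableZl.
Qed.

Lemma normal_exp_ge0 g : (forall x, 0 <= g x) -> 0 <= normal_exp g.
Proof. by move=> g0; apply: Rintegral_ge0 => x _; rewrite mulr_ge0 ?normal_pdf_ge0. Qed.

Lemma normal_exp1 : normal_exp (fun=> 1) = 1.
Proof.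
rewrite /normal_exp; under eq_Rintegral do rewrite mul1r.
by rewrite /Rintegral integral_normal_pdf.
Qed.

Lemma normal_exp_indic x : normal_exp \1_`]-oo, x] = normal_cdf x.
Proof.
rewrite /normal_cdf Rintegral_mkcond; apply: eq_Rintegral => t _.
by rewrite patchE indicE; case: (t \in _); rewrite ?mul1r ?mul0r.
Qed.

Lemma normal_cdf_continuous : continuous normal_cdf.
Proof.
move=> x; apply/differentiable_continuous/derivable1_diffP.
have x1 : x < x + 1 by rewrite ltrDl.
have iphi : mu.-integrable [set` Interval -oo%O (BRight (x + 1))] (EFin \o phi).
  exact: integrableS (integrable_normal_pdf 0 (Num.sqrt v)).
by have [] := continuous_FTC1 x1 iphi (ltNyr x) (continuous_normal_pdf s_neq0 (x := x)).
Qed.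

(** As a random variable under the normal law, the identity has distribution function [normal_cdf],
    so the general limits of distribution functions at infinity apply. *)
Let idTR : measurableTypeR R -> R := idfun.

#[local]
HB.instance Definition _ :=
  @isMeasurableFun.Build _ _ _ _ idTR (@measurable_id _ _ setT).

Lemma normal_cdf_y (e : R) : 0 < e ->
  exists r : R, 0 < r /\ 1 - e <= normal_cdf r - normal_cdf (- r).
Proof.
move=> e0; pose X : {RV (normal_prob 0 (Num.sqrt v)) >-> R} := idTR.
have /fine_cvgP[_ cy] := cvg_cdfy1 X.
have /fine_cvgP[_] := cvg_cdfNy0 X.
rewrite cvgNy_compNP => cNy; have e2 : 0 < e / 2 by rewrite divr_gt0.
have /cvgrPdist_le/(_ _ e2) H1 := cy.
have /cvgrPdist_le/(_ _ e2) H2 := cNy.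
have [r [[/= ry rNy] r0]] :=
  filter_ex (filterI (filterI H1 H2) (nbhs_pinfty_gt (num_real 0))).
have {}ry : `|1 - normal_cdf r| <= e / 2 := ry.
have {}rNy : `|0 - normal_cdf (- r)| <= e / 2 := rNy.
exists r; split => //; move: ry rNy; rewrite !ler_norml; lra.
Qed.

(* [f] solves Stein's equation [v f' - x f = v psi]; [psi] having mean zero, [f]
   vanishes outside the support of [psi]. *)
Lemma stein_solution psi k r :
  (forall x y, `|psi y - psi x| <= k * `|y - x|) ->
  (forall x, r < `|x| -> psi x = 0) -> normal_exp psi = 0 ->
  exists f df c, [/\ forall x, v * df x - x * f x = v * psi x,
    forall x, `|df x| <= c &
    forall x y, `|f y - f x - df x * (y - x)| <= c * (y - x) ^+ 2].
Proof.
move=> psik psi0 Epsi.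
have psic := lipschitz_continuous psik.
have mpsi : measurable_fun setT psi by exact: continuous_measurable_fun.
have [kpsi psib] := continuous_compact_support_bounded psic psi0.
have ipsi := integrable_normal_exp mpsi psib.
have phic : continuous phi by exact: continuous_normal_pdf.
(* Since [phi' = - (x / v) phi], Stein's equation amounts to [(f phi)' = psi phi], so [f] is a
   primitive of [psi phi] divided by [phi]. *)
pose H x := \int[mu]_(t in `]-oo, x]) (psi t * phi t).
have dH x : is_derive x (1 : R) H (psi x * phi x).
  have x1 : x < x + 1 by rewrite ltrDl.
  have i1 : mu.-integrable [set` Interval -oo%O (BRight (x + 1))]
      (EFin \o (fun t => psi t * phi t)) by exact: integrableS ipsi.
  have cx : {for x, continuous (fun t => psi t * phi t)}.
    by apply: continuousM; [exact: psic|exact: phic].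
    have [dH HE] := continuous_FTC1 x1 i1 (ltNyr x) cx.
  by apply: DeriveDef; [exact: dH|rewrite -derive1E; exact: HE].
(* To the right of the support this is the full integral, zero by [Epsi]; to the left the integrand
   vanishes. *)
have H0 x : r < `|x| -> H x = 0.
  rewrite /H Rintegral_mkcond lter_normr => /orP[rx|xr].
    rewrite -[RHS]Epsi; apply: eq_Rintegral => t _; rewrite patchE.
    case: ifPn => // /negP; rewrite inE /= in_itv /= => /negP; rewrite -ltNge => xt.
    by rewrite psi0 ?mul0r// (lt_le_trans _ (ler_norm t))// (lt_trans rx).
  rewrite -[RHS](mul0r (fine (mu setT))) -Rintegral_cst//.
  apply: eq_Rintegral => t _; rewrite patchE; case: ifPn => // /set_mem /=.
  rewrite in_itv /= => tx; rewrite psi0 ?mul0r// -normrN.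
  by rewrite (lt_le_trans _ (ler_norm _))// (lt_le_trans xr)// lerN2.
pose f x := H x / phi x.
pose df x := psi x + x / v * f x.
have phi_neq0 x : phi x != 0 by rewrite gt_eqF// normal_pdf_gt0.
have df_f (x : R) : is_derive x 1 f (df x).
  have dphi := is_derive_normal_pdf x.
  have dphiV := is_deriveV (phi_neq0 x) dphi.
  apply: is_derive_eq; rewrite /GRing.scale /= /df /f.
  have v_neq0 : v != 0 by rewrite gt_eqF.
  by move: (phi_neq0 x); set y := phi x => y_neq0; field; rewrite y_neq0.
have f0 x : r < `|x| -> f x = 0 by move=> /H0; rewrite /f => ->; rewrite mul0r.
have df0 x : r < `|x| -> df x = 0.
  by move=> xr; rewrite /df psi0// f0// mulr0 addr0.
have fc : continuous f by exact: is_derive_continuous df_f.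
have xc : continuous (fun x : R => x / v).
  by move=> x; apply: cvgM; [exact: cvg_id|exact: cvg_cst].
have dfc : continuous df.
  move=> x; apply: (@continuousD R R^o R^o psi (fun x => x / v * f x)); first exact: psic.
  by apply: continuousM; [exact: xc|exact: fc].
(* [psi] is only Lipschitz, so [df] is not differentiated as a whole: its summand [x / v * f x] is,
   with derivative [d2], and the two Lipschitz constants add up. *)
pose d2 x := v^-1 * f x + x / v * df x.
have d2c : continuous d2.
  move=> x; apply: (@continuousD R R^o R^o (fun x => v^-1 * f x) (fun x => x / v * df x)).
    by apply: continuousM; [exact: cvg_cst|exact: fc].
  by apply: continuousM; [exact: xc|exact: dfc].
have d20 x : r < `|x| -> d2 x = 0.
  by move=> xr; rewrite /d2 f0// df0// !mulr0 addr0.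
have [k1 dfb] := continuous_compact_support_bounded dfc df0.
have [k2 d2b] := continuous_compact_support_bounded d2c d20.
have dxf (x : R) : is_derive x 1 (fun x => x / v * f x) (d2 x).
  have := df_f x => ?.
  apply: is_derive_eq; rewrite /GRing.scale /= /d2.
  by ring.
have xf_lip := is_derive_lipschitz dxf d2b.
have df_lip x y : `|df y - df x| <= (k + k2) * `|y - x|.
  rewrite /df opprD addrACA mulrDl; apply: le_trans (ler_normD _ _) _.
  by apply: lerD; [exact: psik|exact: xf_lip].
exists f, df, (Num.max k1 (k + k2)); split.
- by move=> x; rewrite /df; field; rewrite gt_eqF.
- by move=> x; rewrite le_max dfb.
- move=> x y; apply: le_trans (is_derive_taylor1 df_f df_lip x y) _.
  by rewrite ler_wpM2r ?sqr_ge0// le_max lexx orbT.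
Qed.

End NormalExpectation.

(** * Trapezoidal test functions *)

Section Clamp.
Variable R : realType.
Implicit Types x d r s t w : R.

Definition clamp t : R := Num.max 0 (Num.min 1 t).

Lemma clamp_itv t : 0 <= clamp t <= 1.
Proof. by rewrite /clamp le_max lexx ge_max ler01 ge_min lexx. Qed.

Lemma clamp_lipschitz s t : `|clamp t - clamp s| <= `|t - s|.
Proof.
rewrite ler_norml /clamp; case: (leP 1 s) => ?; case: (leP 1 t) => ?;
  case: (leP 0 s) => ?; case: (leP 0 t) => ?; case: (leP 0 (1 : R)) => ?;
  case: (ger0P (t - s)) => ?; lra.
Qed.

Lemma clamp1 t : 1 <= t -> clamp t = 1.
Proof. by move=> t1; rewrite /clamp min_l// max_r. Qed.

Lemma clamp0 t : t <= 0 -> clamp t = 0.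
Proof. by move=> t0; rewrite /clamp min_r ?max_l// (le_trans t0). Qed.

(** [bump r] is 1 on [[-r, r]] and vanishes outside [[-r-1, r+1]]. For [d > 0], [ramp x d] falls
    linearly from 1 at [x] to 0 at [x + d], and [cut_ramp] gives it compact support. *)
Definition bump r w : R := clamp (r + 1 - `|w|).
Definition ramp x d w : R := clamp ((x + d - w) / d).
Definition cut_ramp r x d w : R := Num.min (bump r w) (ramp x d w).

Lemma bump_lipschitz r s t : `|bump r t - bump r s| <= 1 * `|t - s|.
Proof.
apply: le_trans (clamp_lipschitz _ _) _; rewrite mul1r.
have -> : r + 1 - `|t| - (r + 1 - `|s|) = `|s| - `|t| by ring.
by rewrite distrC; exact: ler_dist_dist.
Qed.

Lemma ramp_lipschitz x d s t : 0 < d -> `|ramp x d t - ramp x d s| <= d^-1 * `|t - s|.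
Proof.
move=> d0; apply: le_trans (clamp_lipschitz _ _) _.
have dV : 0 <= d^-1 by rewrite invr_ge0 ltW.
rewrite -mulrBl normrM (ger0_norm dV) mulrC ler_wpM2l//.
have -> : x + d - t - (x + d - s) = s - t by ring.
by rewrite distrC.
Qed.

Lemma cut_ramp_lipschitz r x d s t : 0 < d ->
  `|cut_ramp r x d t - cut_ramp r x d s| <= (1 + d^-1) * `|t - s|.
Proof.
move=> d0; have := bump_lipschitz r s t; have := ramp_lipschitz x s t d0.
rewrite mulrDl; set a := d^-1 * _; set b := 1 * _.
rewrite /cut_ramp !ler_norml; case: (leP (bump r t)) => ?;
  case: (leP (bump r s)) => ?; lra.
Qed.

Lemma cut_ramp_itv r x d w : 0 <= cut_ramp r x d w <= bump r w.
Proof.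
rewrite /cut_ramp le_min ge_min lexx andbT.
have /andP[-> _] := clamp_itv (r + 1 - `|w|).
by have /andP[-> _] := clamp_itv ((x + d - w) / d).
Qed.

Lemma bump_eq0 r w : r + 1 < `|w| -> bump r w = 0.
Proof. by move=> rw; apply: clamp0; lra. Qed.

Lemma bump_eq1 r w : `|w| <= r -> bump r w = 1.
Proof. by move=> rw; apply: clamp1; lra. Qed.

(** Pointwise form of Chebyshev's inequality: taking expectations bounds the tails by the second
    moment. *)
Lemma onem_bump_le r w : 0 < r -> 1 - bump r w <= r ^- 2 * w ^+ 2.
Proof.
move=> r0; have [wr|rw] := leP `|w| r.
  by rewrite bump_eq1// subrr mulr_ge0 ?invr_ge0 ?sqr_ge0.
have /andP[b0 _] := clamp_itv (r + 1 - `|w|).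
apply: (@le_trans _ _ 1); first by rewrite /bump; lra.
rewrite mulrC ler_pdivlMr ?exprn_gt0// mul1r -(real_normK (num_real w)).
by rewrite lerXn2r ?nnegrE// ltW.
Qed.

Lemma ramp_eq1 x d w : 0 < d -> w <= x -> ramp x d w = 1.
Proof.
by move=> d0 wx; apply: clamp1; rewrite ler_pdivlMr// mul1r; lra.
Qed.

Lemma ramp_eq0 x d w : 0 < d -> x + d <= w -> ramp x d w = 0.
Proof.
by move=> d0 wx; apply: clamp0; rewrite pmulr_lle0 ?invr_gt0//; lra.
Qed.

Lemma indic_le_cut_ramp r x d w : 0 < d ->
  (w <= x)%R%:R <= cut_ramp r x d w + (1 - bump r w).
Proof.
move=> d0; have /andP[c0 _] := cut_ramp_itv r x d w.
have /andP[b0 b1] : 0 <= bump r w <= 1 := clamp_itv _.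
case: (leP w x) => wx /=.
  by rewrite /cut_ramp ramp_eq1// min_l// addrC subrK.
by rewrite mulr0n addr_ge0// subr_ge0.
Qed.

Lemma cut_ramp_le_indic r x d w : 0 < d -> cut_ramp r x d w <= (w <= x + d)%R%:R.
Proof.
move=> d0; case: (leP w (x + d)) => wx; rewrite /cut_ramp ge_min.
  by have /andP[_ ->] := clamp_itv (r + 1 - `|w|).
by rewrite ramp_eq0 ?lexx ?orbT// ltW.
Qed.

End Clamp.

(** * Stein's method for positive normalised linear functionals *)

Section SteinMethod.
Variables (R : realType) (v K : R) (E : nat -> (R -> R) -> R).
Hypothesis v_gt0 : 0 < v.
Hypothesis E_cst : forall n c, E n (fun=> c) = c.
Hypothesis EB : forall n g h, E n (fun x => g x - h x) = E n g - E n h.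
Hypothesis EZ : forall n c g, E n (fun x => c * g x) = c * E n g.
Hypothesis E_le : forall n (g h : R -> R), (forall x, g x <= h x) -> E n g <= E n h.
Hypothesis E_sq : forall n, E n (fun x => x ^+ 2) <= K.
Hypothesis E_stein : forall (f df : R -> R) c, (forall x, `|df x| <= c) ->
  (forall x y, `|f y - f x - df x * (y - x)| <= c * (y - x) ^+ 2) ->
  E n (fun x => v * df x - x * f x) @[n --> \oo] --> 0.

Notation N := (normal_exp v).

Let measurable_bump (r : R) : measurable_fun setT (bump r).
Proof.
apply: continuous_measurable_fun.
by apply: (@lipschitz_continuous _ _ 1) => x y; exact: bump_lipschitz.
Qed.

Let measurable_cut_ramp (r x d : R) : 0 < d -> measurable_fun setT (cut_ramp r x d).
Proof.
move=> d0; apply: continuous_measurable_fun.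
by apply: (@lipschitz_continuous _ _ (1 + d^-1)) => s t; exact: cut_ramp_lipschitz.
Qed.

Let bump_le1 (r x : R) : `|bump r x| <= 1.
Proof. by rewrite ger0_norm; case/andP: (clamp_itv (r + 1 - `|x|)). Qed.

Let cut_ramp_le1 (r x d w : R) : `|cut_ramp r x d w| <= 1.
Proof.
have /andP[c0 cb] := cut_ramp_itv r x d w.
rewrite ger0_norm//; apply: le_trans cb _.
exact: le_trans (ler_norm _) (bump_le1 r w).
Qed.

Let indic_le1 (A : set R) x : `|\1_A x : R| <= 1.
Proof. by rewrite indicE normr_nat lern1 leq_b1. Qed.

Let indicE' (x w : R) : \1_`]-oo, x] w = (w <= x)%R%:R :> R.
Proof.
rewrite indicE (_ : (w \in _) = (w <= x)%R)//.
by apply/idP/idP; rewrite inE /= in_itv.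
Qed.

(** Subtracting this multiple of [bump r] makes the normal mean zero and keeps the support compact,
    so that [stein_solution] applies. *)
Lemma cvg_stein_cut_ramp (r x d : R) : 0 < d -> 0 < N (bump r) ->
  E n (cut_ramp r x d) - N (cut_ramp r x d) / N (bump r) * E n (bump r)
    @[n --> \oo] --> 0.
Proof.
move=> d0 Nb0; set c := _ / _.
pose psi w := cut_ramp r x d w - c * bump r w.
have psi_lip s t : `|psi t - psi s| <= (1 + d^-1 + `|c|) * `|t - s|.
  rewrite /psi opprD addrACA -opprD -mulrBr mulrDl.
  apply: le_trans (ler_normB _ _) _; apply: lerD; first exact: cut_ramp_lipschitz.
  by rewrite normrM ler_wpM2l// (le_trans (bump_lipschitz _ _ _))// mul1r.
have psi0 w : r + 1 < `|w| -> psi w = 0.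
  move=> rw; rewrite /psi bump_eq0// mulr0 subr0.
  have := cut_ramp_itv r x d w; rewrite bump_eq0// => w0.
  by apply/eqP; rewrite eq_le andbC.
have Npsi : N psi = 0.
  rewrite /psi (@normal_expBZ _ v _ _ 1 c)//; last exact: measurable_cut_ramp.
  by rewrite /c divfK ?subrr// gt_eqF.
have [f [df [k [steq dfk fk]]]] := stein_solution v_gt0 psi_lip psi0 Npsi.
rewrite (_ : (fun n => _) = (fun n => v^-1 * E n (fun x => v * df x - x * f x))).
  by rewrite -(mulr0 v^-1); apply: cvgM; [exact: cvg_cst|exact: E_stein dfk fk].
apply/funext => n; rewrite -!EZ -EB; congr (E n _); apply/funext => x'.
by rewrite steq mulKf ?gt_eqF.
Qed.

Lemma stein_cdf (x d e : R) : 0 < d -> 0 < e ->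
  \forall n \near \oo, E n (fun w => (w <= x)%R%:R) <= normal_cdf v (x + d) + e /\
    normal_cdf v x - e <= E n (fun w => (w <= x + d)%R%:R).
Proof.
(* Three errors of size [e'] will occur: the cut-off tail, the limit in [cvg_stein_cut_ramp], and
   the mass missing from the bump. The bound [2^-1] keeps [N (bump r)] positive. *)
move=> d0 e0; pose e' := Num.min (e / 3) 2^-1.
have e'0 : 0 < e' by rewrite lt_min invr_gt0 ltr0n andbT divr_gt0.
have e'3 : 3 * e' <= e.
  have : e' <= e / 3 by rewrite ge_min lexx.
  by lra.
have e'2 : e' <= 2^-1 by rewrite ge_min lexx orbT.
have [r0 [r0_gt0 r0e]] := normal_cdf_y v e'0.
have K0 : 0 <= K.
  by apply: le_trans (E_sq 0); rewrite -(E_cst 0 0); apply: E_le => w; exact: sqr_ge0.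
(* [r0] controls the normal tail; [r >= 1] and [r >= K / e'] give [K <= e' * r ^+ 2] for the tail
   under [E]. *)
pose r := Num.max r0 (Num.max 1 (K / e')).
have r_gt0 : 0 < r by rewrite lt_max r0_gt0.
have Kr : r ^- 2 * K <= e'.
  rewrite mulrC ler_pdivrMr ?exprn_gt0//.
  have r1 : 1 <= r by rewrite !le_max lexx orbT.
  have Ke : K / e' <= r by rewrite !le_max lexx !orbT.
  rewrite ler_pdivrMr// mulrC in Ke.
  apply: le_trans Ke _; rewrite (ler_wpM2l (ltW e'0))//.
  by rewrite expr2 ler_peMr// ltW.
have Nb1 : N (bump r) <= 1.
  rewrite -[leRHS](normal_exp1 v); apply: (@le_normal_exp _ v v_gt0 _ _ 1) => //.
    by move=> w; rewrite normr1.
  by move=> w; exact: le_trans (ler_norm _) (bump_le1 r w).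
have NbK : 1 - e' <= N (bump r).
  apply: le_trans r0e _; rewrite -!(normal_exp_indic v) -[X in _ - X]mul1r.
  rewrite -(@normal_expBZ _ v _ _ 1)//.
  apply: (@le_normal_exp _ v v_gt0 _ _ 2) => //.
  - by apply: measurable_funB => //; exact: measurable_funM.
  - move=> w; rewrite mul1r; apply: le_trans (ler_normB _ _) _.
    by apply: le_trans (lerD (indic_le1 _ _) (indic_le1 _ _)) _; lra.
  - by move=> w; apply: le_trans (bump_le1 r w) _; lra.
  move=> w; rewrite mul1r !indicE'.
  have /andP[b0 b1] : 0 <= bump r w <= 1 := clamp_itv _.
  case: (leP w r0) => wr; case: (leP w (- r0)) => rw /=; rewrite ?mulr0n ?mulr1n; try lra.
  rewrite subr0 bump_eq1// (@le_trans _ _ r0)//; last by rewrite le_max lexx.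
  by rewrite ler_norml wr ltW.
have Nb_gt0 : 0 < N (bump r) by lra.
have Nc0 : 0 <= N (cut_ramp r x d).
  by apply: normal_exp_ge0 => w; have /andP[] := cut_ramp_itv r x d w.
have Ncb : N (cut_ramp r x d) <= N (bump r).
  apply: (@le_normal_exp _ v v_gt0 _ _ 1) => //; first exact: measurable_cut_ramp.
  by move=> w; have /andP[] := cut_ramp_itv r x d w.
have NcF : N (cut_ramp r x d) <= normal_cdf v (x + d).
  rewrite -normal_exp_indic; apply: (@le_normal_exp _ v v_gt0 _ _ 1) => //.
    exact: measurable_cut_ramp.
  by move=> w; rewrite indicE'; exact: cut_ramp_le_indic.
have FNc : normal_cdf v x <= N (cut_ramp r x d) + (1 - N (bump r)).
  rewrite -lerBlDl -[X in _ - X <= _]mul1r -[X in _ <= _ - X]mul1r.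
  rewrite -(normal_exp_indic v) -{2}(normal_exp1 v).
  rewrite -!(@normal_expBZ _ v _ _ 1)//; last 2 first.
  - by move=> w; rewrite normr1.
  - exact: measurable_cut_ramp.
  have m1 : measurable_fun setT (fun w => \1_`]-oo, x] w - 1 * cut_ramp r x d w).
    apply: measurable_funB => //; apply: measurable_funM => //.
    exact: measurable_cut_ramp.
  have m2 : measurable_fun setT (fun w : R => 1 - 1 * bump r w).
    by apply: measurable_funB => //; exact: measurable_funM.
  apply: (le_normal_exp v_gt0 m1 m2 (k := 2)) => w; rewrite mul1r.
  - apply: le_trans (ler_normB _ _) _.
    by apply: le_trans (lerD (indic_le1 _ _) (cut_ramp_le1 _ _ _ _)) _; lra.
  - apply: le_trans (ler_normB _ _) _; rewrite normr1.
    by apply: le_trans (lerD (lexx _) (bump_le1 _ _)) _; lra.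
  by rewrite mul1r indicE' lerBlDl indic_le_cut_ramp.
have Eb1 n : E n (bump r) <= 1.
  rewrite -[leRHS](E_cst n); apply: E_le => w.
  exact: le_trans (ler_norm _) (bump_le1 r w).
have EbK n : 1 - e' <= E n (bump r).
  have : E n (fun w => 1 - bump r w) <= E n (fun w => r ^- 2 * w ^+ 2).
    by apply: E_le => w; exact: onem_bump_le.
  rewrite EB EZ E_cst; have := ler_wpM2l _ (E_sq n) => /(_ (r ^- 2)).
  by rewrite invr_ge0 sqr_ge0 => /(_ isT); lra.
have Ec n : E n (fun w => (w <= x)%R%:R) <= E n (cut_ramp r x d) + (1 - E n (bump r)).
  rewrite -lerBlDl -[X in _ <= X - _](E_cst n) -!EB.
  by apply: E_le => w; rewrite lerBlDl; exact: indic_le_cut_ramp.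
have cE n : E n (cut_ramp r x d) <= E n (fun w => (w <= x + d)%R%:R).
  by apply: E_le => w; exact: cut_ramp_le_indic.
have /cvgrPdist_le/(_ _ e'0) := cvg_stein_cut_ramp x d0 Nb_gt0.
apply: filterS => n; rewrite sub0r normrN.
set c := _ / _ => dist.
have c01 : 0 <= c <= 1
  by apply/andP; split; [apply: divr_ge0 => //; exact: ltW|rewrite ler_pdivrMr// mul1r].
have cN : c * N (bump r) = N (cut_ramp r x d) by rewrite divfK// gt_eqF.
move: dist (Ec n) (cE n) (Eb1 n) (EbK n); rewrite ler_norml.
set Ea := E n (cut_ramp _ _ _); set Eb := E n (bump r) => dist Ecn cEn Eb1n EbKn.
(* Both masses lie between [1 - e'] and 1, and [0 <= c <= 1]. *)
have : `|c * (Eb - N (bump r))| <= e'.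
  rewrite normrM -[leRHS]mul1r ler_pM//; first by rewrite ger0_norm; case/andP: c01.
  by rewrite ler_norml; lra.
rewrite mulrBr cN ler_norml => ?; split; lra.
Qed.

End SteinMethod.

(** * Central limit theorem *)

Section MartingaleCLT.
Variables (R : realType) (p : R) (A : bool -> bool -> R).
Hypotheses (p_ge0 : 0 <= p) (p_le1 : p <= 1).

Local Notation v := (mart_var p A).
Hypothesis v_gt0 : 0 < v.

(** This is [n^(-1/2)] for [n = k + 4] squares, which carry [k + 2] links. *)
Definition clt_scale (k : nat) : R := (Num.sqrt k.+4%:R)^-1.
Local Notation W k s := (clt_scale k * mart p A true true s).

Lemma clt_scale_gt0 k : 0 < clt_scale k.
Proof. by rewrite invr_gt0 sqrtr_gt0. Qed.

Lemma clt_scale_sq k : clt_scale k ^+ 2 = k.+4%:R^-1.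
Proof. by rewrite exprVn sqr_sqrtr. Qed.

Lemma clt_scale_le1 k : clt_scale k <= 1.
Proof.
rewrite invf_le1 ?sqrtr_gt0// -[leLHS](sqrtr1 R).
by apply: ler_wsqrtr; rewrite ler1n.
Qed.

Lemma cvg_clt_scale : clt_scale k @[k --> \oo] --> 0.
Proof.
rewrite (_ : clt_scale = Num.sqrt \o (fun k => harmonic (k + 3)%N)); last first.
  by apply/funext => k; rewrite /= /harmonic /clt_scale sqrtrV ?addn3.
have h3 : (fun k => @harmonic R (k + 3)%N) k @[k --> \oo] --> 0.
  by rewrite cvg_shiftn; exact: cvg_harmonic.
have := continuous_cvg _ (@sqrt_continuous R 0) h3; rewrite sqrtr0.
by apply.
Qed.

(** Up to the error of [mart_stein], the expectation is that of [(v - e ^+ 2 * T) * df W] with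
    [e = clt_scale k]; the variance bound [bern_exp_var] and the mean of [T] show that [e ^+ 2 * T]
    is within [O(e)] of [v] in mean. *)
Lemma mart_clt_stein (f df : R -> R) c : (forall x, `|df x| <= c) ->
  (forall x y, `|f y - f x - df x * (y - x)| <= c * (y - x) ^+ 2) ->
  exists C, forall k, `|bern_exp p k.+2 (fun s => v * df (W k s) - W k s * f (W k s))|
    <= C * clt_scale k.
Proof.
move=> dfc fc.
have c_ge0 : 0 <= c := le_trans (normr_ge0 _) (dfc 0).
have [B A_le] : exists B, forall a b, `|A a b| <= B.
  exists (`|A true true| + `|A true false| + `|A false true| + `|A false false|).
  have n0 a b := normr_ge0 (A a b).
  have := n0 true true; have := n0 true false; have := n0 false true.
  by have := n0 false false; move=> ? ? ? ? [] []; lra.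
have B_ge0 : 0 <= B := le_trans (normr_ge0 _) (A_le true true).
pose T := grad p A true true.
pose u a b := p * (1 - p) * A a b ^+ 2 - v.
pose kap := u true true + (p * u true true + (1 - p) * u true false).
have ET k : bern_exp p k.+2 T = k.+2%:R * v + kap.
  by rewrite /T (bern_exp_grad p_ge0 p_le1 A_le) mart_sq -addrA.
(* A variance part and a squared bias part; [2 * v] arises because there are [k + 2] bits while the
   scaling uses [k + 4]. *)
pose Z := (40 * B ^+ 2) ^+ 2 + (kap - 2 * v) ^+ 2.
exists (25 * B ^+ 3 * c + c * (1 + Z)) => k.
set m := k.+2; set e := clt_scale k.
have e_gt0 : 0 < e := clt_scale_gt0 k.
have e_le1 : e <= 1 := clt_scale_le1 k.
have me : m%:R * e ^+ 2 = 1 - 2 * e ^+ 2.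
  rewrite /e clt_scale_sq (_ : m%:R = k.+4%:R - 2).
    by rewrite mulrBl divff// pnatr_eq0.
  by rewrite -[k.+4]addn2 natrD addrK.
have e2_ge0 := sqr_ge0 e.
have me_le1 : m%:R * e ^+ 2 <= 1 by rewrite me; lra.
have VT : bern_exp p m (fun s => (T s - bern_exp p m T) ^+ 2) <= m%:R * (40 * B ^+ 2) ^+ 2.
  by apply: bern_exp_var => // w1 w2 _; exact: grad_flip_le.
have L2 : bern_exp p m (fun s => (e ^+ 2 * T s - v) ^+ 2) <= e ^+ 2 * Z.
  rewrite (@eq_bern_exp _ _ _ _ (fun s => e ^+ 4 * (T s - bern_exp p m T) ^+ 2 +
    (2 * e ^+ 2 * (e ^+ 2 * bern_exp p m T - v)) * (T s - bern_exp p m T) +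
    (e ^+ 2 * bern_exp p m T - v) ^+ 2)); last by move=> s _; ring.
  rewrite !bern_expD !bern_expZ bern_expB !bern_exp_cst subrr mulr0 addr0 ET.
  have -> : e ^+ 2 * (m%:R * v + kap) - v = e ^+ 2 * (kap - 2 * v).
    by rewrite mulrDr mulrA (mulrC _ m%:R) me; ring.
  rewrite [leRHS]mulrDr lerD//.
    have e4 : 0 <= e ^+ 4 by rewrite (exprM e 2 2) sqr_ge0.
    rewrite ET in VT; apply: le_trans (ler_wpM2l e4 VT) _.
    set z := (40 * B ^+ 2) ^+ 2; have z_ge0 : 0 <= z := sqr_ge0 _.
    have -> : e ^+ 4 * (m%:R * z) = (m%:R * e ^+ 2) * (e ^+ 2 * z) by ring.
    by rewrite ler_piMl// mulr_ge0.
  set y := kap - 2 * v.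
  have -> : e ^+ 2 * y * (e ^+ 2 * y) = e ^+ 2 * (e ^+ 2 * y ^+ 2) by ring.
  apply: ler_piMl; first by rewrite mulr_ge0 ?sqr_ge0.
  by rewrite expr_le1// ltW.
(* From second to first moment by [|t| <= e + t^2 / e]. *)
have L1 : bern_exp p m (fun s => `|e ^+ 2 * T s - v|) <= e * (1 + Z).
  apply: (@le_trans _ _ (bern_exp p m (fun s => e + e^-1 * (e ^+ 2 * T s - v) ^+ 2))).
    apply: ler_bern_exp => // s _; set t := _ - v.
    have t2 : `|t| ^+ 2 = t ^+ 2 by rewrite real_normK ?num_real.
    rewrite -t2 -(ler_pM2l e_gt0) mulrDr mulVKf ?gt_eqF//.
    by have := sqr_ge0 (`|t| - e); have := mulr_ge0 (ltW e_gt0) (normr_ge0 t); nra.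
  rewrite bern_expD bern_exp_cst bern_expZ [leRHS]mulrDr mulr1 lerD2l.
  rewrite ler_pdivrMl//; apply: le_trans L2 _.
  by rewrite expr2 mulrA.
pose F s := df (0 + e * mart p A true true s).
have S1 := mart_stein p_ge0 p_le1 A_le e m true true 0 fc.
have D1 : bern_exp p m (fun s => v * df (W k s) - W k s * f (W k s)) =
   - bern_exp p m (fun s => (e ^+ 2 * T s - v) * F s) -
   e * (bern_exp p m (fun s => mart p A true true s * f (0 + e * mart p A true true s))
        - e * bern_exp p m (fun s => T s * F s)).
  rewrite -bern_expZ -bern_expB -bern_expZ -[X in X - _]mulN1r -bern_expZ -bern_expB.
  apply: eq_bern_exp => s _; rewrite /F -/e !add0r.
  set M := mart p A true true s; set y := df (e * M); set z := f (e * M).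
  by move: M v (T s) y z => M v' Ts y z; ring.
rewrite D1; apply: le_trans (ler_normB _ _) _; rewrite normrN normrM (gtr0_norm e_gt0).
rewrite mulrDl addrC lerD//.
  rewrite mulrC ler_wpM2r ?(ltW e_gt0)//; apply: le_trans S1 _.
  rewrite mulrCA.
  by rewrite ler_piMr// !mulr_ge0// exprn_ge0.
apply: le_trans (ler_norm_bern_exp p_ge0 p_le1 _ _) _.
rewrite -mulrA [_ * e]mulrC.
apply: le_trans (ler_wpM2l c_ge0 L1); rewrite -bern_expZ.
by apply: ler_bern_exp => // s _; rewrite normrM mulrC ler_wpM2r//; exact: dfc.
Qed.

Lemma mart_clt (x d e : R) : 0 < d -> 0 < e ->
  \forall k \near \oo,
    bern_exp p k.+2 (fun s => (W k s <= x)%R%:R) <= normal_cdf v (x + d) + e /\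
    normal_cdf v x - e <= bern_exp p k.+2 (fun s => (W k s <= x + d)%R%:R).
Proof.
pose E k (g : R -> R) := bern_exp p k.+2 (fun s => g (W k s)).
pose u a b := p * (1 - p) * A a b ^+ 2 - v.
pose kap := u true true + (p * u true true + (1 - p) * u true false).
(* By [mart_sq] the second moment of [W] is [((k + 2) * v + kap) / (k + 4)], at most [v + |kap|]. *)
apply: (@stein_cdf R v (v + `|kap|) E) => //.
- by move=> n c; exact: bern_exp_cst.
- by move=> n g h; exact: bern_expB.
- by move=> n c g; exact: bern_expZ.
- by move=> n g h gh; apply: ler_bern_exp => // s _; exact: gh.
- move=> k; rewrite /E (@eq_bern_exp _ _ _ _
    (fun s => clt_scale k ^+ 2 * mart p A true true s ^+ 2)); last first.
    by move=> s _; rewrite exprMn.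
  rewrite bern_expZ mart_sq clt_scale_sq ler_pdivrMl// -addrA -/kap.
  rewrite [leRHS]mulrDr lerD//.
    by rewrite (ler_wpM2r (ltW v_gt0))// ler_nat -[k.+4]addn2 leq_addr.
  by apply: le_trans (ler_norm _) _; rewrite ler_peMl// ler1n.
move=> f df c dfc fc; have [C HC] := mart_clt_stein dfc fc.
apply/norm_cvg0P; apply: (@squeeze_cvgr _ _ _ _ (fun=> 0) (fun k => C * clt_scale k)).
- by near=> k; rewrite /= normr_ge0 HC.
- exact: cvg_cst.
- by rewrite -(mulr0 C); apply: cvgM; [exact: cvg_cst|exact: cvg_clt_scale].
Unshelve. all: by end_near. Qed.

End MartingaleCLT.

(** * Martingale approximation of the index *)

Section ZagrebMartingale.
Variables (R : realType) (p : R).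

Local Notation bit b := ((b : nat)%:R : R).

(** The coefficient of the new link [x] in [window_sq a b x] plus [zc1_corr b x], that is, its
    effect on the present window and on the expectation of the next two. *)
Definition zc1_coef (a b : bool) : R :=
  - 18 + 2 * p - 2 * p ^+ 2 - 2 * p * bit b + 2 * bit a - 2 * bit a * bit b.

Lemma mart_var_zc1 : mart_var p zc1_coef = zc1_var p.
Proof. by rewrite /mart_var /zc1_coef /zc1_var /=; ring. Qed.

Lemma zc1_var_gt0 : 0 < p -> p < 1 -> 0 < zc1_var p.
Proof.
move=> p0 p1; rewrite /zc1_var mulr_gt0//.
  by rewrite !mulr_gt0// subr_gt0.
have p2 : 0 <= p ^+ 2 := sqr_ge0 p.
have p3 : p ^+ 3 <= p ^+ 2 by rewrite exprS ler_piMl// ltW.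
have p4 : 0 <= p ^+ 4 by rewrite exprn_ge0// ltW.
lra.
Qed.

(* Expected excess of the next two windows over the mean, given the last two links. *)
Definition zc1_corr (a b : bool) : R :=
  (50 - 9 * bit a - 9 * p + 2 * bit a * p - 2 * bit a * bit b * p - zc1_mean_coef p) +
  (50 - 9 * bit b - 9 * p + 2 * bit b * p - 2 * bit b * p ^+ 2 - zc1_mean_coef p).

(** The Poisson equation: a centred window is a martingale increment plus a difference of [zc1_corr]
    that telescopes in [link_sum_mart]. *)
Lemma window_sqE (a b x : bool) : (window_sq a b x)%:R - zc1_mean_coef p =
  (bit x - p) * zc1_coef a b + zc1_corr a b - zc1_corr b x.
Proof.
by case: a; case: b; case: x;
  rewrite /window_sq /zc1_coef /zc1_corr /zc1_mean_coef /=; ring.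
Qed.

Lemma link_sum_mart a b s : exists a' b',
  (link_sum a b s)%:R - zc1_mean_coef p * (size s)%:R =
  mart p zc1_coef a b s + zc1_corr a b - zc1_corr a' b'.
Proof.
elim: s a b => [|x s IH] a b; first by exists a, b; rewrite /=; ring.
have [a' [b' E]] := IH b x; exists a', b'.
have := window_sqE a b x; rewrite [link_sum _ _ _]/= [size _]/= -natr1 natrD /= => W.
rewrite -[_ + mart _ _ _ _ _ + _]addrA.
rewrite (_ : _ - _ = ((window_sq a b x)%:R - zc1_mean_coef p) +
  ((link_sum b x s)%:R - zc1_mean_coef p * (size s)%:R)); last by ring.
by rewrite W E; ring.
Qed.

(** The bound collects the two ends of the telescoping sum, the remainder of [ZC1_link_sum], the gap
    between [k] windows and [k + 4] squares, and the first two increments, started from the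
    fictitious links [true], [true]. *)
Lemma ZC1_mart_dist : exists C, forall k s, size s = k.+2 ->
  `|(ZC1 s)%:R - zc1_mean_coef p * k.+4%:R - mart p zc1_coef true true s| <= C.
Proof.
pose tot (f : bool -> bool -> R) :=
  `|f true true| + `|f true false| + `|f false true| + `|f false false|.
have tot_le f a b : `|f a b| <= tot f.
  rewrite /tot; have n0 a' b' := normr_ge0 (f a' b').
  have := n0 true true; have := n0 true false; have := n0 false true.
  by have := n0 false false; case: a; case: b; lra.
have bit_le (x : bool) : `|bit x - p| <= 1 + `|p|.
  by apply: le_trans (ler_normB _ _) _; rewrite lerD2r; case: x; rewrite ?normr0 ?normr1 //.
exists (2 * tot zc1_corr + 4000 + 4 * `|zc1_mean_coef p| +
  2 * ((1 + `|p|) * tot zc1_coef)) => k [|a [|b s]] //= [sk].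
have [r r_le ->] := ZC1_link_sum a b s.
have [a' [b']] := link_sum_mart a b s; rewrite sk => E.
have -> : (link_sum a b s + r)%:R - zc1_mean_coef p * k.+4%:R -
    ((bit a - p) * zc1_coef true true + ((bit b - p) * zc1_coef true a +
      mart p zc1_coef a b s)) =
    zc1_corr a b - zc1_corr a' b' + r%:R - 4 * zc1_mean_coef p -
    ((bit a - p) * zc1_coef true true + (bit b - p) * zc1_coef true a).
  have -> : zc1_corr a b - zc1_corr a' b' = (link_sum a b s)%:R -
    zc1_mean_coef p * k%:R - mart p zc1_coef a b s by rewrite E; ring.
  by rewrite natrD -[k.+4]addn4 natrD; ring.
have xA (x u w : bool) : `|(bit x - p) * zc1_coef u w| <= (1 + `|p|) * tot zc1_coef.
  by rewrite normrM ler_pM.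
have r4 : `|r%:R| <= 4000 :> R by rewrite normr_nat ler_nat.
have h1 := tot_le zc1_corr a b; have h2 := tot_le zc1_corr a' b'.
have h3 := xA a true true; have h4 := xA b true a.
apply: le_trans (ler_normB _ _) _; apply: lerD.
  apply: le_trans (ler_normB _ _) _; rewrite normrM normr_nat lerD2r.
  apply: le_trans (ler_normD _ _) _; apply: lerD => //.
  apply: le_trans (ler_normB _ _) _; lra.
apply: le_trans (ler_normD _ _) _; lra.
Qed.

Lemma zc1_cdf_bern_exp n x : zc1_cdf p n x = bern_exp p (n - 2)
  (fun s => (((ZC1 s)%:R - zc1_mean_coef p * n%:R) / Num.sqrt n%:R <= x)%R%:R).
Proof.
rewrite -sum_ffun_bern_exp /zc1_cdf big_mkcond; apply: eq_bigr => L _.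
by rewrite -/(links_seq L); case: ifP => _; rewrite ?mulr1 ?mulr0.
Qed.

End ZagrebMartingale.

(* Convergence in distribution to N(0, sigma^2), sigma^2 = zc1_var p > 0,
   stated as pointwise convergence of distribution functions at every x
   (the normal distribution function is continuous everywhere).
   normal_prob m s is the normal law with mean m and standard deviation s. *)
Theorem theorem3 (R : realType) (p : R) (hp0 : 0 < p) (hp1 : p < 1) :
  forall x : R,
    (fun n : nat => (zc1_cdf p n x)%:E) @ \oo -->
      normal_prob 0 (Num.sqrt (zc1_var p)) `]-oo, x].
Proof.
move=> x; have v_gt0 := zc1_var_gt0 hp0 hp1; set v := zc1_var p in v_gt0 *.
have [p_ge0 p_le1] := (ltW hp0, ltW hp1).
rewrite normal_cdfE; apply: cvg_EFin; first exact: nearW.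
rewrite -(cvg_shiftn 4); apply/cvgrPdist_le => e e_gt0.
have e2 : 0 < e / 2 by rewrite divr_gt0.
have /cvgrPdist_le/(_ _ e2)/nbhs_ballP[d0 /= d0_gt0 Fd] := normal_cdf_continuous v_gt0 (x := x).
(* The argument is moved by [d] twice, for the ramp in [mart_clt] and for replacing the index by the
   martingale; [2 * d < d0] stays within the modulus of continuity. *)
pose d := d0 / 3; have d_gt0 : 0 < d by rewrite divr_gt0.
have Fy (y : R) : `|x - y| <= 2 * d -> `|normal_cdf v x - normal_cdf v y| <= e / 2.
  by move=> xy; apply: Fd; rewrite /ball /=; apply: le_lt_trans xy _; rewrite /d; lra.
have F1 := Fy (x + d + d); have F2 := Fy (x - d - d).
have [C ZC1C] := ZC1_mart_dist p.
have vE : mart_var p (zc1_coef p) = v := mart_var_zc1 p.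
have mv_gt0 : 0 < mart_var p (zc1_coef p) by rewrite vE.
have up := mart_clt p_ge0 p_le1 mv_gt0 (x + d) d_gt0 e2.
have lo := mart_clt p_ge0 p_le1 mv_gt0 (x - d - d) d_gt0 e2.
have Ce : \forall k \near \oo, `|C * clt_scale R k| <= d.
  have cC : C * clt_scale R k @[k --> \oo] --> 0.
    by rewrite -(mulr0 C); apply: cvgM; [exact: cvg_cst|exact: cvg_clt_scale].
  have /cvgrPdist_le/(_ _ d_gt0) := cC.
  by apply: filterS => k; rewrite sub0r normrN.
move: up lo Ce; apply: filterS3 => k [+ _] [_ +] Cek.
rewrite vE subrK /= addn4 zc1_cdf_bern_exp (_ : (k.+4 - 2)%N = k.+2)//.
set W := fun s => clt_scale R k * mart p (zc1_coef p) true true s.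
have dist s : size s = k.+2 ->
    `|((ZC1 s)%:R - zc1_mean_coef p * k.+4%:R) / Num.sqrt k.+4%:R - W s| <= d.
  move=> sk; rewrite mulrC -mulrBr normrM; apply: le_trans Cek.
  rewrite normrM mulrC ler_wpM2r//; apply: le_trans (ZC1C k s sk) _; exact: ler_norm.
set P := bern_exp _ _ (fun s => (_ / _ <= x)%R%:R) => up_k lo_k.
have P_up : P <= bern_exp p k.+2 (fun s => (W s <= x + d)%R%:R).
  apply: ler_bern_exp => // s sk; rewrite ler_nat; have := dist s sk.
  by rewrite ler_norml => h; case: leP => // ?; case: (leP (W s)) => // ?; lra.
have P_lo : bern_exp p k.+2 (fun s => (W s <= x - d)%R%:R) <= P.
  apply: ler_bern_exp => // s sk; rewrite ler_nat; have := dist s sk.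
  by rewrite ler_norml => h; case: (leP (W s)) => // ?; case: leP => // ?; lra.
have {}F1 : `|normal_cdf v x - normal_cdf v (x + d + d)| <= e / 2.
  by apply: F1; rewrite ler_norml; lra.
have {}F2 : `|normal_cdf v x - normal_cdf v (x - d - d)| <= e / 2.
  by apply: F2; rewrite ler_norml; lra.
have := le_trans P_up up_k; have := le_trans lo_k P_lo.
by move: F1 F2; rewrite !ler_norml; lra.
Qed.
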